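(* Let $G=(V,E)$ be a digraph and let $t,t'\in B_n$ with $t\neq t'$. Write $H=H_{t,t'}$, $M=M_{t,t'}$, $L=L_{t,t'}$, $Y=Y_{t,t'}$, $Z=Z_{t,t'}$, $\omega=\omega_{t,t'}$, $\lambda=\lambda_{t,t'}$. Then the graph algebra $\mathbb{A}(G)$ satisfies the identity $t\approx t'$ if and only if all of the following conditions hold: (i) every nontrivial strongly connected component of $G$ is a whirl; (ii) there is no path from a nontrivial strongly connected component of $G$ to another one; (iii) $M_G$ divides $M$; (iv) $P_G<H$; (v) $E_G\le L+1$; (vi) $O_G\le Y+1$; (vii) $Z_G<Z$; (viii) $B_G<L$; (ix) $\omega_G(L+1,r)<\omega(r)$ for all $r\in\{1,\dots,L+1\}$; (x) if $E_G=L+1$, then $\lambda_G<\lambda$.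
   Context: Digraphs $G=(V,E)$ have $E\subseteq V\times V$, loops allowed, and may be infinite. A walk of length $k$ is a sequence $v_0\to v_1\to\dots\to v_k$ with $(v_{i-1},v_i)\in E$; a path is a walk with distinct vertices. A strongly connected component (SCC) is trivial if it consists of a single vertex without a loop, nontrivial otherwise. For $m\ge1$, an $m$-whirl is a digraph whose vertex set is partitioned into nonempty blocks $B_0,\dots,B_{m-1}$ (indices mod $m$) with edge set exactly $\bigcup_i B_i\times B_{i+1}$; $B_{i-1}$ is the predecessor block of $B_i$. A whirl is an $m$-whirl for some $m$. Comparisons involve the extended integers with $-\infty<$ every integer $<\infty$. Graph algebra: $\mathbb{A}(G)$ is the groupoid on $V\cup\{\infty\}$ ($\infty\notin V$) with $xy=x$ if $x,y\in V$ and $(x,y)\in E$, and $xy=\infty$ otherwise; it satisfies $t\approx t'$ if $t,t'$ induce the same term operation on it. Bracketings: $B_n$ is the set of binary terms in which $x_1,\dots,x_n$ each occur once, in this order. For a bracketing $t$, the tree $G(t)$ is defined recursively: $G(x_i)$ is the single vertex $x_i$; if $t=t_1t_2$, then $G(t)$ is $G(t_1)\cup G(t_2)$ plus an edge from the leftmost variable of $t_1$ to the leftmost variable of $t_2$; it is rooted at $x_1$ with edges directed away from the root. For a rooted tree $T$: $d_T(x)$ is the depth of $x$, $h(T)$ the height, $T_x$ the rooted induced subtree consisting of $x$ and all its descendants (equality $T_x=T'_x$ means equal vertex and edge sets). Parameters of $t\ne t'$, with $T=G(t)$, $T'=G(t')$, $X_n=\{x_1,\dots,x_n\}$: $H_{t,t'}=\min(h(T),h(T'))$;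 $M_{t,t'}=\gcd\{|d_T(x)-d_{T'}(x)|:x\in X_n\}$; $L_{t,t'}$ is the largest $m$ such that for all $x$, $d_T(x)\le m$ or $d_{T'}(x)\le m$ implies $d_T(x)=d_{T'}(x)$; $Y_{t,t'}$ is the largest $m$ such that for all $x$, $h(T_x)\le m$ or $h(T'_x)\le m$ implies $T_x=T'_x$; $Z_{t,t'}$ is the smallest $m\ge0$ such that some $x$ has $T_x=T'_x$, $h(T_x)=m$, and different parents in $T$ and $T'$. Let $\Delta=\{x:T_x\ne T'_x\}$, $\Omega=\{(d_T(x),h(T_x)),(d_{T'}(x),h(T'_x)):x\in\Delta\}$, $\xi=\min\{d+h:(d,h)\in\Omega\}$, and for integers $r\ge0$ let $\omega_{t,t'}(r)=\min\{d+h:(d,h)\in\Omega,\ d\le r\}$ if $r<\xi$ and $\omega_{t,t'}(r)=\xi$ if $r\ge\xi$. Let $\Lambda=\{x:d_T(x)\ne d_{T'}(x),\ L_{t,t'}+1\in\{d_T(x),d_{T'}(x)\}\}$ and $\lambda_{t,t'}=\min\{\max(h(T_x),h(T'_x)):x\in\Lambda\}$. Parameters of $G$: $M_G$ is the lcm of all $m$ such that some SCC of $G$ is an $m$-whirl ($1$ if none, $\infty$ if unbounded). A walk is pleasant if all its vertices lie in trivial SCCs. For a nontrivial SCC $K$, an entryway to $K$ is a path $v_0\to\dots\to v_\ell$ with $v_0\to\dots\to v_{\ell-1}$ pleasant and $v_\ell\in K$; an outlet from $K$ is a path $v_0\to\dots\to v_\ell$ with $v_0\in K$ and $v_1\to\dots\to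 v_\ell$ pleasant. $P_G,E_G,O_G$ are the maximal lengths of a pleasant path, entryway, outlet respectively ($\infty$ if unbounded, $-\infty$ if none exists). $Z_G$ is the largest $m\ge0$ such that some SCC $K$ that is a whirl has a block containing vertices $u,w$, there is a walk $u\to v_0\to\dots\to v_m$, and $(w,v_0)\notin E$. $B_G$ is the largest $m$ such that there are a walk $v_0\to\dots\to v_m$ and edges $v_m\to v_{m+1}$, $v_m\to v'_{m+1}$ with $v_{m+1},v'_{m+1}$ in distinct nontrivial SCCs. For $\ell\ge r\ge1$, $\omega_G(\ell,r)$ is the largest $m$ such that there are a walk $v_0\to\dots\to v_\ell$ with $v_\ell$ in a nontrivial SCC and a walk $v_{r-1}\to v'_r\to v'_{r+1}\to\dots\to v'_m$ with $v'_\ell$ in a trivial SCC. $\lambda_G$ is the largest $m$ such that there are an entryway $u_0\to\dots\to u_{E_G}$ to a nontrivial SCC $K$, a vertex $w\in K$ with $(w,u_{E_G})\in E$, and a walk $v_0\to\dots\to v_m$ such that exactly one of $(w,v_0)$, $(u_{E_G-1},v_0)$ is an edge. For $Z_G,B_G,\omega_G,\lambda_G$: the value is $\infty$ if there is no finite bound and $-\infty$ if no such $m$ exists. *)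

(* Defs.v *)
From HB Require Import structures.
From mathcomp Require Import all_boot all_order all_algebra.
From mathcomp Require Import boolp classical_sets constructive_ereal.

Set Implicit Arguments.
Unset Strict Implicit.
Unset Printing Implicit Defensive.

Import Order.TTheory GRing.Theory Num.Theory.

Local Open Scope classical_set_scope.

Definition xmax (P : int -> Prop) : \bar int :=
  if pselect (exists m, P m /\ forall k, P k -> (k <= m)%R) then
    (xget 0%R [set m | P m /\ forall k, P k -> (k <= m)%R])%:E
  else if pselect (exists m, P m) then +oo%E else -oo%E.

Definition xmin (P : int -> Prop) : \bar int :=
  if pselect (exists m, P m /\ forall k, P k -> (m <= k)%R) then
    (xget 0%R [set m | P m /\ forall k, P k -> (m <= k)%R])%:E
  else if pselect (exists m, P m) then -oo%E else +oo%E.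

Definition natP (P : nat -> Prop) : int -> Prop :=
  fun m => exists k : nat, m = (k%:Z)%R /\ P k.

Section Digraph.
Context {V : Type} (E : V -> V -> Prop).

Definition is_walk (w : nat -> V) (k : nat) : Prop :=
  forall i, i < k -> E (w i) (w i.+1).

Definition is_path (w : nat -> V) (k : nat) : Prop :=
  is_walk w k /\ forall i j, i <= k -> j <= k -> w i = w j -> i = j.

Definition reach (u v : V) : Prop :=
  exists (w : nat -> V) (k : nat), is_walk w k /\ w 0 = u /\ w k = v.

Definition is_scc (K : set V) : Prop :=
  exists v, K = [set u | reach u v /\ reach v u].

Definition trivial_scc (K : set V) : Prop :=
  is_scc K /\ exists v, K = [set v] /\ ~ E v v.

Definition nontrivial_scc (K : set V) : Prop :=
  is_scc K /\ ~ trivial_scc K.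

Definition in_trivial_scc (v : V) : Prop :=
  exists K, trivial_scc K /\ K v.

Definition in_nontrivial_scc (v : V) : Prop :=
  exists K, nontrivial_scc K /\ K v.

Definition whirl_blocks (K : set V) (m : nat) (B : nat -> set V) : Prop :=
  0 < m /\
  (forall i, i < m -> exists v, B i v) /\
  (forall i, i < m -> B i `<=` K) /\
  (forall v, K v -> exists i, i < m /\ B i v) /\
  (forall i j v, i < m -> j < m -> B i v -> B j v -> i = j) /\
  (forall u v, K u -> K v ->
     (E u v <-> exists i, i < m /\ B i u /\ B (i.+1 %% m) v)).

Definition is_mwhirl (K : set V) (m : nat) : Prop :=
  exists B, whirl_blocks K m B.

Definition is_whirl (K : set V) : Prop := exists m, is_mwhirl K m.

(* M_G : lcm of the m such that some SCC is an m-whirl;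
   1 if none, None (= infinity) if unbounded *)
Definition whirl_period (m : nat) : Prop :=
  exists K, is_scc K /\ is_mwhirl K m.

Definition MG : option nat :=
  if pselect (exists b, forall m, whirl_period m -> m <= b) then
    let b := xget 0 [set b | forall m, whirl_period m -> m <= b] in
    Some (\big[lcmn/1]_(m < b.+1 | `[< whirl_period m >]) (m : nat))
  else None.

Definition PG : \bar int :=
  xmax (natP (fun k => exists w, is_path w k /\
           forall i, i <= k -> in_trivial_scc (w i))).

Definition is_entryway (w : nat -> V) (l : nat) (K : set V) : Prop :=
  is_path w l /\ (forall i, i < l -> in_trivial_scc (w i)) /\
  nontrivial_scc K /\ K (w l).

Definition EG : \bar int :=
  xmax (natP (fun l => exists w K, is_entryway w l K)).

Definition is_outlet (w : nat -> V) (l : nat) (K : set V) : Prop :=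
  is_path w l /\ nontrivial_scc K /\ K (w 0) /\
  (forall i, 0 < i <= l -> in_trivial_scc (w i)).

Definition OG : \bar int :=
  xmax (natP (fun l => exists w K, is_outlet w l K)).

(* Z_G : walk u -> v_0 -> ... -> v_m is f 0 = u, f (j.+1) = v_j *)
Definition ZG : \bar int :=
  xmax (natP (fun m => exists K p B i u w (f : nat -> V),
    is_scc K /\ whirl_blocks K p B /\ i < p /\ B i u /\ B i w /\
    is_walk f m.+1 /\ f 0 = u /\ ~ E w (f 1))).

Definition BG : \bar int :=
  xmax (natP (fun m => exists (f : nat -> V) a b K K',
    is_walk f m /\ E (f m) a /\ E (f m) b /\
    nontrivial_scc K /\ nontrivial_scc K' /\ K <> K' /\ K a /\ K' b)).

(* omega_G(l, r), for l >= r >= 1: the walk v_{r-1} -> v'_r -> ... -> v'_m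
   is g (r-1) -> g r -> ... -> g m with g (r-1) = f (r-1) = v_{r-1} *)
Definition omegaG (l r : nat) : \bar int :=
  xmax (natP (fun m => exists f g : nat -> V,
    is_walk f l /\ in_nontrivial_scc (f l) /\
    g r.-1 = f r.-1 /\ (forall i, r.-1 <= i < m -> E (g i) (g i.+1)) /\
    l <= m /\ in_trivial_scc (g l))).

Definition lambdaG_at (e : nat) : \bar int :=
  xmax (natP (fun m => exists (u : nat -> V) K w (v : nat -> V),
    is_entryway u e K /\ K w /\ E w (u e) /\ is_walk v m /\
    (E w (v 0) <-> ~ E (u e.-1) (v 0)))).

Definition lambdaG : \bar int :=
  match EG with
  | EFin (Posz e) => lambdaG_at e
  | _ => -oo%E
  end.

(* graph algebra A(G) on option V, with None playing the role of infinity *)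
Definition gmul (x y : option V) : option V :=
  match x, y with
  | Some u, Some v => if `[< E u v >] then Some u else None
  | _, _ => None
  end.

End Digraph.

(* Bracketings: binary terms in x_1, ..., x_n, each once, in order.     *)
(* A bracketing is its shape; variable x_(i+1) is represented by i.     *)

Inductive bterm : Type := BLeaf | BNode of bterm & bterm.

Fixpoint nleaves (t : bterm) : nat :=
  match t with BLeaf => 1 | BNode a b => nleaves a + nleaves b end.

Definition in_B (n : nat) (t : bterm) : Prop := nleaves t = n.

Fixpoint beval {A : Type} (op : A -> A -> A) (a : nat -> A) (off : nat)
  (t : bterm) : A :=
  match t with
  | BLeaf => a off
  | BNode t1 t2 => op (beval op a off t1) (beval op a (off + nleaves t1) t2)
  end.

Definition satisfies {V : Type} (E : V -> V -> Prop) (t t' : bterm) : Prop :=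
  forall a : nat -> option V, beval (gmul E) a 0 t = beval (gmul E) a 0 t'.

(* the tree G(t): vertices 0..n-1 (for x_1..x_n), root 0;
   for t = t1 t2, G(t) = G(t1) ∪ G(t2) (shifted) + edge from the leftmost
   variable of t1 (which is 0) to the leftmost variable of t2 *)
Fixpoint gedges (t : bterm) : seq (nat * nat) :=
  match t with
  | BLeaf => [::]
  | BNode t1 t2 =>
      let k := nleaves t1 in
      gedges t1 ++ [seq (e.1 + k, e.2 + k) | e <- gedges t2] ++ [:: (0, k)]
  end.

Fixpoint walkb (es : seq (nat * nat)) (u v k : nat) : bool :=
  if k is k'.+1 then has (fun e : nat * nat => (e.1 == u) && walkb es e.2 v k') es
  else u == v.

Definition tdist (t : bterm) (u v : nat) : nat :=
  find (walkb (gedges t) u v) (iota 0 (nleaves t)).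

Definition tdesc (t : bterm) (u v : nat) : bool :=
  has (walkb (gedges t) u v) (iota 0 (nleaves t)).

Definition depth (t : bterm) (x : nat) : nat := tdist t 0 x.

Definition sub_edges (t : bterm) (x : nat) : seq (nat * nat) :=
  [seq e <- gedges t | tdesc t x e.1 && tdesc t x e.2].

Definition sub_height (t : bterm) (x : nat) : nat :=
  \max_(y <- iota 0 (nleaves t) | tdesc t x y) tdist t x y.

Definition height (t : bterm) : nat := sub_height t 0.

Definition tparent (t : bterm) (x : nat) : option nat :=
  ohead [seq e.1 | e <- gedges t & e.2 == x].

Definition subtree_eq (t t' : bterm) (x : nat) : Prop :=
  (forall y, tdesc t x y = tdesc t' x y) /\
  (forall e, (e \in sub_edges t x) = (e \in sub_edges t' x)).

Section TermParams.
Variables t t' : bterm.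
Let n := nleaves t.

Definition tH : nat := minn (height t) (height t').

Definition tM : nat :=
  \big[gcdn/0]_(x < n)
    ((depth t x - depth t' x) + (depth t' x - depth t x))%N.

Definition tL : \bar int :=
  xmax (fun m => forall x, x < n ->
    ((depth t x)%:Z <= m \/ (depth t' x)%:Z <= m)%R -> depth t x = depth t' x).

Definition tY : \bar int :=
  xmax (fun m => forall x, x < n ->
    ((sub_height t x)%:Z <= m \/ (sub_height t' x)%:Z <= m)%R ->
    subtree_eq t t' x).

Definition tZ : \bar int :=
  xmin (natP (fun m => exists x, x < n /\ subtree_eq t t' x /\
    sub_height t x = m /\ tparent t x <> tparent t' x)).

Definition inOmega (p : nat * nat) : Prop :=
  exists x, x < n /\ ~ subtree_eq t t' x /\
    (p = (depth t x, sub_height t x) \/ p = (depth t' x, sub_height t' x)).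

Definition txi : \bar int :=
  xmin (natP (fun s => exists p, inOmega p /\ s = p.1 + p.2)).

Definition tomega (r : nat) : \bar int :=
  if ((r%:Z)%:E < txi)%E then
    xmin (natP (fun s => exists p, inOmega p /\ p.1 <= r /\ s = p.1 + p.2))
  else txi.

Definition tlambda : \bar int :=
  xmin (natP (fun s => exists x, x < n /\ depth t x <> depth t' x /\
    ((depth t x)%:Z%:E = tL + 1 \/ (depth t' x)%:Z%:E = tL + 1)%E /\
    s = maxn (sub_height t x) (sub_height t' x))).

End TermParams.

(* Main.v *)
Require Import Defs.
From HB Require Import structures.
From mathcomp Require Import all_boot all_order all_algebra.
From mathcomp Require Import boolp classical_sets constructive_ereal.
From mathcomp Require Import zify ring.

(** The value of a bracketing [t] under an assignment [phi] of vertices is the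
    value of its leftmost variable if [phi] is a homomorphism from the tree [G(t)]
    to [G], and infinity otherwise; so the identity holds iff the two trees have
    the same homomorphisms to [G].  The vertices of [G(t)] are numbered in
    preorder, so the tree is encoded by its depth sequence.

    Necessity: two kinds of maps are homomorphisms from [T].  Mapping each vertex
    to the vertex of a walk indexed by its depth, at the first vertex where the
    depths differ, shows that walks of length [q + 1] inside (or leaving) a
    nontrivial component collapse to edges, which makes the component a whirl.
    Redirecting one subtree [T_x] along a second walk violates the identity
    whenever one of the numerical conditions fails.

    Sufficiency: given a homomorphism [phi] from [T] and a vertex [x] whose parents
    [p] in [T] and [q] in [T'] differ, look at the ancestor [a] of [x] at depth
    [L], which is the same in both trees.  If [phi a] is in a nontrivial component
    [K], then so is [phi q], in the block of [phi p].  Otherwise some child of [a]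
    is mapped to a nontrivial component, by the condition on [omega_G]; all such
    children go to one block of one component, by the conditions on [B_G] and
    [lambda_G].  In each case [phi q -> phi x] follows from the block structure,
    from [Z_G] or from [lambda_G]. *)

Set Implicit Arguments.
Unset Strict Implicit.
Unset Printing Implicit Defensive.

(** * Trees as depth sequences *)

(** The level [L] shapes both directions. The trees agree up to depth [L], and some vertex has depth
    [L + 1] in one tree and is deeper in the other, so its parents lie at depth [L] and beyond [L].
    The test homomorphisms for [E_G], [B_G] and [lambda_G] place the end of an entryway or the fork
    between two components at levels [L] and [L + 1], where this vertex sees the difference. Most
    necessity arguments use only one inclusion between the two sets of homomorphisms and are applied
    again with the trees exchanged.

    In the sufficiency part the leverage is that a proper ancestor [t] of [x] with [T_t = T'_t]
    would give [x] the same parent in both trees. So whenever a condition yields such a [t] above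
    [x], it is [x] itself, and none can lie above [q]; this is how [phi q] is shown to lie in a
    nontrivial component when [q] differs from [a].

    Lying in a nontrivial component is expressed as lying on a closed walk, so many steps amount to
    this: an edge pointing backwards would close a cycle. *)

Lemma eqmod_add1 m a b x y : a = b %[mod m] -> x + a = y + b -> x = y %[mod m].
Proof.
move=> ab xy; apply/eqP; rewrite -(eqn_modDr a) xy.
by rewrite eqn_modDl; apply/eqP/esym.
Qed.

Lemma eqmodD m a b c e : a = b %[mod m] -> c = e %[mod m] ->
  a + c = b + e %[mod m].
Proof. by move=> ab ce; rewrite -modnDm ab ce modnDm. Qed.

(** Congruences are handled without subtraction: known congruences are added to the two sides until
    the sums are literally equal, which is left to [lia]. *)
Lemma eqmod_add2 m a b c e x y : a = b %[mod m] -> c = e %[mod m] ->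
  x + a + c = y + b + e -> x = y %[mod m].
Proof. by move=> ab ce xy; apply: (eqmod_add1 (eqmodD ab ce)); rewrite !addnA. Qed.

Lemma eqmod_add3 m a b c e f g x y : a = b %[mod m] -> c = e %[mod m] ->
  f = g %[mod m] -> x + a + c + f = y + b + e + g -> x = y %[mod m].
Proof.
by move=> ab ce fg xy; apply: (eqmod_add2 (eqmodD ab ce) fg); rewrite !addnA.
Qed.

(* The last [j < m] with [d j < c]; the junk value is 0. *)
Fixpoint last_below (d : nat -> nat) m c :=
  if m is m'.+1 then if d m' < c then m' else last_below d m' c else 0.

Lemma last_belowP d m c : 0 < m -> d 0 < c ->
  [/\ last_below d m c < m, d (last_below d m c) < c
    & forall i, last_below d m c < i < m -> c <= d i].
Proof.
move=> + d0; elim: m => // m IH _ /=; case: ifP => [dm|dm].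
  by split => // i; lia.
have m0 : 0 < m by case: m dm {IH} => //; rewrite d0.
have [h1 h2 h3] := IH m0; split => //; first lia.
move=> i; rewrite ltnS => /andP[ji]; rewrite leq_eqVlt => /orP[/eqP->|im].
  by rewrite leqNgt dm.
by apply: h3; rewrite ji.
Qed.

Lemma last_below_eq d m c j : j < m -> d j < c ->
  (forall i, j < i < m -> c <= d i) -> last_below d m c = j.
Proof.
elim: m => // m IH jm dj h /=.
have [jem|jnm] := eqVneq j m; first by rewrite -jem dj.
have : c <= d m by apply: h; lia.
rewrite leqNgt => /negbTE ->; apply: IH => // [|i hi]; first lia.
by apply: h; lia.
Qed.

Lemma eq_last_below d d' m c c' :
  (forall i, i < m -> (d i < c) = (d' i < c')) ->
  last_below d m c = last_below d' m c'.
Proof.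
elim: m => // m IH h /=; rewrite (h m (leqnn _)); case: ifP => // _.
by apply: IH => i im; apply: h; lia.
Qed.

Definition par (d : nat -> nat) x := last_below d x (d x).
(** For [k <= d x] in a depth sequence, this is the ancestor of [x] at depth [k]. *)
Definition up (d : nat -> nat) x k := last_below d x.+1 k.+1.
Definition anc (d : nat -> nat) x y := up d y (d x) == x.
Definition hgt n (d : nat -> nat) x :=
  \max_(y <- iota 0 n | anc d x y) (d y - d x).

(* The depth sequences of rooted trees on [0 .. n-1] numbered in preorder; [par]
   and [anc] recover the tree. *)
Definition depthseq n (d : nat -> nat) :=
  d 0 = 0 /\ forall i, i.+1 < n -> 0 < d i.+1 <= (d i).+1.

Section Tree.
Context (n : nat) (d : nat -> nat) (dT : depthseq n d).
Implicit Types x y z k : nat.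

Let d0 : d 0 = 0. Proof. by case: dT. Qed.

(** In preorder the descendants of [x] form an interval: [x] and the vertices after it up to the
    next one that is not deeper. *)
Lemma ancP x y : reflect (x <= y /\ forall z, x < z <= y -> d x < d z) (anc d x y).
Proof.
apply: (iffP eqP) => [e|[xy h]].
  have dx : d 0 < (d x).+1 by rewrite d0.
  have [h1 _ h3] := last_belowP (ltn0Sn y) dx.
  rewrite -/(up d y (d x)) e in h1 h3; split; first lia.
  by move=> z hz; have := h3 z; lia.
by apply: last_below_eq => // i hi; apply: h; lia.
Qed.

Lemma anc_refl x : anc d x x. Proof. by apply/ancP; split => // z; lia. Qed.

Lemma anc_leq x y : anc d x y -> x <= y. Proof. by case/ancP. Qed.

Lemma anc_depth x y : anc d x y -> d x <= d y.
Proof.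
case/ancP => xy h; have [->//|xny] := eqVneq x y.
by apply/ltnW/h; lia.
Qed.

Lemma anc_depth_lt x y : anc d x y -> x != y -> d x < d y.
Proof. by case/ancP => xy h xny; apply: h; lia. Qed.

Lemma anc_trans y x z : anc d x y -> anc d y z -> anc d x z.
Proof.
move=> a1 a2; have dxy := anc_depth a1.
case/ancP: a1 => xy h; case/ancP: a2 => yz g; apply/ancP; split; first lia.
move=> i hi; have [iy|yi] := leqP i y; first by apply: h; lia.
by apply: (leq_ltn_trans dxy); apply: g; lia.
Qed.

Lemma anc_between x y z : anc d x y -> x <= z <= y -> anc d x z.
Proof.
case/ancP => xy h hz; apply/ancP; split; first lia.
by move=> i hi; apply: h; lia.
Qed.

Lemma anc_total x y z : anc d x z -> anc d y z -> d x <= d y -> anc d x y.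
Proof.
case/ancP => xz h; case/ancP => yz g dxy; apply/ancP.
have xy : x <= y by rewrite leqNgt; apply/negP => yx; have := g x; lia.
by split => // i hi; apply: h; lia.
Qed.

Lemma anc_anti x y : anc d x y -> anc d y x -> x = y.
Proof. by move=> /anc_leq ? /anc_leq ?; lia. Qed.

Lemma depth_gt0 x : 0 < x < n -> 0 < d x.
Proof. by case: x => // x hx; case: dT => _ /(_ x hx) /andP[]. Qed.

Lemma anc0 x : x < n -> anc d 0 x.
Proof.
by move=> xn; apply/ancP; split => // z hz; rewrite d0; apply: depth_gt0; lia.
Qed.

Lemma depth_leq x : x < n -> d x <= x.
Proof.
elim: x => [|x IH] xn; first by rewrite d0.
by have := IH (ltnW xn); case: dT => _ /(_ x xn); lia.
Qed.

Lemma upP y k : y < n -> k <= d y -> d (up d y k) = k /\ anc d (up d y k) y.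
Proof.
move=> yn ky; have dk : d 0 < k.+1 by rewrite d0.
have [h1 h2 h3] := last_belowP (ltn0Sn y) dk; rewrite -/(up d y k) in h1 h2 h3.
(* Depths grow by at most one from a vertex to its successor, so the last vertex of depth at most
   [k] has depth exactly [k]. *)
have dup : d (up d y k) = k.
  have [e|ne] := eqVneq (up d y k) y; first by rewrite e in h2 *; lia.
  have := h3 (up d y k).+1; case: dT => _ /(_ (up d y k)); lia.
split => //; apply/ancP; split; first lia.
by move=> z hz; have := h3 z; lia.
Qed.

Lemma anc_up x y : anc d x y -> up d y (d x) = x.
Proof. by move/eqP. Qed.

Lemma up_id x : up d x (d x) = x.
Proof. exact: anc_up (anc_refl x). Qed.

Lemma parP x : 0 < x < n ->
  [/\ par d x < x, d x = (d (par d x)).+1 & anc d (par d x) x].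
Proof.
move=> hx; have dx : d 0 < d x by rewrite d0; apply: depth_gt0.
have x0 : 0 < x by lia.
have [h1 h2 h3] := last_belowP x0 dx; rewrite -/(par d x) in h1 h2 h3.
have term_depth : d x = (d (par d x)).+1.
  have [e|ne] := eqVneq (par d x).+1 x.
    have := proj2 dT (par d x); rewrite e; lia.
  have := h3 (par d x).+1; case: dT => _ /(_ (par d x)); lia.
split => //; apply/ancP; split; first lia.
move=> z hz; have [->|zx] := eqVneq z x; first lia.
by have := h3 z; lia.
Qed.

Lemma par_lt x : 0 < x < n -> par d x < x. Proof. by case/parP. Qed.
Lemma par_depth x : 0 < x < n -> d x = (d (par d x)).+1. Proof. by case/parP. Qed.
Lemma par_anc x : 0 < x < n -> anc d (par d x) x. Proof. by case/parP. Qed.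

Lemma anc_par x y : y < n -> anc d x y -> x != y -> anc d x (par d y).
Proof.
move=> yn xy xny; have y0 : 0 < y < n by have := anc_leq xy; lia.
have [h1 h2 h3] := parP y0; apply: (anc_total xy h3).
by have := anc_depth_lt xy xny; lia.
Qed.

Lemma par_eq x y : y < n -> anc d x y -> d y = (d x).+1 -> par d y = x.
Proof.
move=> yn xy dy; have xny : x != y by apply/eqP => e; rewrite e in dy; lia.
have y0 : 0 < y < n by have := anc_leq xy; lia.
have [h1 h2 h3] := parP y0.
have := anc_par yn xy xny => a1; apply/esym/(anc_anti a1)/(anc_total h3 xy).
lia.
Qed.

Lemma par_up y k : y < n -> k < d y -> par d (up d y k.+1) = up d y k.
Proof.
move=> yn ky; have [e1 a1] := upP yn ky; have [e2 a2] := upP yn (ltnW ky).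
apply: par_eq; [by have := anc_leq a1; lia | | lia].
by apply: (anc_total a2 a1); lia.
Qed.

Lemma up_anc x y k : y < n -> anc d x y -> d x <= k <= d y -> anc d x (up d y k).
Proof.
move=> yn xy /andP[xk ky]; have [e a] := upP yn ky.
by apply: (anc_total xy a); lia.
Qed.

Lemma up_up x y k : y < n -> anc d x y -> k <= d x -> up d y k = up d x k.
Proof.
move=> yn xy kx; have xn : x < n by have := anc_leq xy; lia.
have [e a] := upP xn kx.
by have := anc_up (anc_trans a xy); rewrite e.
Qed.

Lemma up_gt0 y k : y < n -> 0 < k <= d y -> 0 < up d y k < n.
Proof.
move=> yn ky; have [e a] : d (up d y k) = k /\ anc d (up d y k) y by apply: upP; lia.
have := anc_leq a; have : up d y k != 0 by apply/eqP => h; rewrite h in e; lia.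
lia.
Qed.

Lemma anc_ind x (P : nat -> Prop) : P x ->
  (forall y, y < n -> anc d x y -> x < y -> anc d x (par d y) -> P (par d y) -> P y) ->
  forall y, y < n -> anc d x y -> P y.
Proof.
move=> Px IH; move=> y; elim/ltn_ind: y => y IHy yn xy.
have [<-//|xny] := eqVneq x y.
have y0 : 0 < y < n by have := anc_leq xy; lia.
have [h1 h2 h3] := parP y0; have a := anc_par yn xy xny.
apply: IH => //; first by have := anc_leq xy; lia.
by apply: IHy => //; lia.
Qed.

Lemma hgt_ge x y : y < n -> anc d x y -> d y <= d x + hgt n d x.
Proof.
move=> yn xy; rewrite -leq_subLR.
by apply: (@leq_bigmax_seq _ _ _ (fun y => d y - d x)); rewrite ?mem_iota.
Qed.

Lemma hgt_le x k : (forall y, y < n -> anc d x y -> d y <= d x + k) -> hgt n d x <= k.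
Proof.
move=> h; apply/bigmax_leqP_seq => y; rewrite mem_iota => yn xy.
by rewrite leq_subLR; apply: h.
Qed.

Lemma hgt_attained x : x < n ->
  exists y, [/\ y < n, anc d x y & d y = d x + hgt n d x].
Proof.
move=> xn; have ne : exists k, (fun k => has (fun y => anc d x y && (d y == d x + k)) (iota 0 n)) k.
  exists 0; apply/hasP; exists x; rewrite ?mem_iota // anc_refl addn0 eqxx //.
have ub k : has (fun y => anc d x y && (d y == d x + k)) (iota 0 n) -> k <= hgt n d x.
  case/hasP => y; rewrite mem_iota => yn /andP[xy /eqP e].
  by have := @hgt_ge x y yn xy; lia.
case: (ex_maxnP ne ub) => k /hasP[y]; rewrite mem_iota => yn /andP[xy /eqP e] max.
exists y; split => //; rewrite e; congr (_ + _); apply/eqP.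
rewrite eqn_leq ub /=; last by apply/hasP; exists y; rewrite ?mem_iota ?xy ?e /=.
apply: hgt_le => z zn xz.
have := max (d z - d x); rewrite leq_subLR; apply; apply/hasP; exists z.
  by rewrite mem_iota.
by rewrite xz /= subnKC // anc_depth.
Qed.

End Tree.

(** * Pairs of trees: equal subtrees, agreement up to a given depth *)

Section TwoTrees.
Context (n : nat) (d d' : nat -> nat).

(** Same descendants and same depths relative to [x], which in preorder determine the edges. Sums
    are compared to avoid truncated subtraction. *)
Definition same_subtree x := forall y, y < n -> anc d x y = anc d' x y /\
  (anc d x y -> d y + d' x = d' y + d x).

End TwoTrees.

Lemma sub_sym n d d' x : same_subtree n d d' x -> same_subtree n d' d x.
Proof. by move=> h y yn; have [e1 e2] := h y yn; split => // a; rewrite e2 ?e1. Qed.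

Section TwoTreesTheory.
Context (n : nat) (d d' : nat -> nat) (dT : depthseq n d) (dT' : depthseq n d').

(** Both parents of [y] are descendants of [x], where the two depth sequences differ by a constant
    and so select the same vertex. *)
Lemma sub_par x y : same_subtree n d d' x -> y < n -> anc d x y -> x != y ->
  par d y = par d' y.
Proof.
move=> s yn xy xny; have lxy := anc_leq dT xy.
have y0 : 0 < y < n by lia.
have xy' : anc d' x y by have [<-] := s y yn.
have a := anc_par dT yn xy xny; have a' := anc_par dT' yn xy' xny.
have [h1 h2 h3] := parP dT y0; have [k1 k2 k3] := parP dT' y0.
apply: last_below_eq => //.
  have [e /(_ xy) ey] := s y yn; have [e' ep] := s (par d' y) ltac:(lia).
  by move: ep; rewrite e' => /(_ a'); lia.
move=> i hi.
have xi : anc d x i by apply: (anc_between dT xy); have := anc_leq dT' a'; lia.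
have [e /(_ xy) ey] := s y yn; have [_ /(_ xi) ei] := s i ltac:(lia).
have : d' y <= d' i; last by lia.
case/(ancP dT'): k3 => _ /(_ i); lia.
Qed.

Lemma sub_hgt x : same_subtree n d d' x -> hgt n d x = hgt n d' x.
Proof.
move=> s; rewrite /hgt big_seq_cond [RHS]big_seq_cond.
have e i : (i \in iota 0 n) && anc d x i = (i \in iota 0 n) && anc d' x i.
  by rewrite mem_iota; case: ltnP => //= ni; have [] := s i ni.
rewrite (eq_bigl _ _ e); apply: eq_bigr => y; rewrite -e mem_iota => /andP[yn xy].
by have [_ /(_ xy)] := s y yn; lia.
Qed.

Lemma sub_intro x :
  (forall y, y < n -> anc d' x y -> anc d x y /\ d' y + d x <= d y + d' x) ->
  (forall y, y < n -> anc d x y -> anc d' x y /\ d y + d' x <= d' y + d x) ->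
  same_subtree n d d' x.
Proof.
move=> h g y yn; split.
  by apply/idP/idP => a; [case: (g y yn a) | case: (h y yn a)].
by move=> a; have [a' ?] := g y yn a; have [_ ?] := h y yn a'; lia.
Qed.

Section Level.
Variable L : nat.
Hypothesis lev : forall x, x < n -> d x <= L \/ d' x <= L -> d x = d' x.

Lemma lev_leq x k : x < n -> k <= L -> (d x <= k) = (d' x <= k).
Proof.
move=> xn kL; apply/idP/idP => h.
  by rewrite -lev //; left; lia.
by rewrite lev //; right; lia.
Qed.

(** The parent of a vertex of depth [k + 1] depends only on which vertices have depth at most [k],
    so agreement up to [L] settles parents up to depth [L + 1]. *)
Lemma lev_par x : x < n -> d x = d' x -> d x <= L.+1 -> par d x = par d' x.
Proof.
move=> xn e dx; apply: eq_last_below => i ix; rewrite -e.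
case: (d x) dx => [|k] dx; first by rewrite !ltn0.
by rewrite !ltnS lev_leq //; lia.
Qed.

Lemma lev_up x k : x < n -> k <= L -> up d x k = up d' x k.
Proof.
by move=> xn kL; apply: eq_last_below => i ix; rewrite !ltnS lev_leq //; lia.
Qed.

Lemma lev_anc x y : y < n -> x < n -> d x <= L -> anc d x y = anc d' x y.
Proof.
move=> yn xn dx; rewrite /anc -(@lev x) //; last by left.
by rewrite lev_up.
Qed.

End Level.
End TwoTreesTheory.

(** * Walks, components and whirls *)

Section Graph.
Context {V : Type} (E : V -> V -> Prop).
Implicit Types (u v x y z : V) (w f g s : nat -> V) (k l m : nat) (K : set V).

(** Walks as a relation between endpoints and length, for concatenating, splitting and counting. *)
Fixpoint wlk k u v : Prop :=
  if k is k'.+1 then exists z, E u z /\ wlk k' z v else u = v.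

(** Cyclic vertices, those with a closed walk of positive length, are exactly the members of
    nontrivial components ([in_nontrivialP]). *)
Definition cyc v := exists k, wlk k.+1 v v.
Definition sc u v := reach E u v /\ reach E v u.
Definition scc v : set V := [set u | sc u v]%classic.

Lemma wlkP k u v : wlk k u v <-> exists w, is_walk E w k /\ w 0 = u /\ w k = v.
Proof.
split.
  elim: k u => [u <-|k IH u [z [uz /IH[w [hw [w0 wk]]]]]].
    by exists (fun=> u); split => // i; lia.
  exists (fun i => if i is j.+1 then w j else u); split => //.
  by case => [|i] ik; [rewrite w0 | apply: hw].
elim: k u => [u [w [_ [-> ->]]]//|k IH u [w [hw [w0 wk]]]].
exists (w 1); rewrite -w0; split; first exact: hw.
by apply: IH; exists (fun i => w i.+1); split => // i ik; apply: hw.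
Qed.

Lemma reachP u v : reach E u v <-> exists k, wlk k u v.
Proof.
split => [[w [k h]]|[k /wlkP[w h]]]; first by exists k; apply/wlkP; exists w.
by exists w, k.
Qed.

Lemma wlk_cat k l u v z : wlk k u v -> wlk l v z -> wlk (k + l) u z.
Proof.
elim: k u => [u -> //|k IH u [y [uy yv]] vz].
by exists y; split => //; apply: IH.
Qed.

Lemma wlk_split k l u z : wlk (k + l) u z -> exists v, wlk k u v /\ wlk l v z.
Proof.
elim: k u => [|k IH] u; first by exists u.
by move=> [y [uy /IH[v [yv vz]]]]; exists v; split => //; exists y.
Qed.

Lemma wlk1 u v : wlk 1 u v <-> E u v.
Proof. by split => [[z [uz <-]]//|uv]; exists v. Qed.

Lemma wlk_rep q k u : wlk k u u -> wlk (q * k) u u.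
Proof. by move=> h; elim: q => // q IH; rewrite mulSn; apply: wlk_cat h IH. Qed.

Lemma walk_wlk w k i j : is_walk E w k -> i <= j <= k -> wlk (j - i) (w i) (w j).
Proof.
move=> hw ij; apply/wlkP; exists (fun a => w (i + a)).
split; last by rewrite addn0 subnKC //; case/andP: ij.
by move=> a ha; rewrite addnS; apply: hw; lia.
Qed.

Lemma walk_reach w k i j : is_walk E w k -> i <= j <= k -> reach E (w i) (w j).
Proof. by move=> hw ij; apply/reachP; exists (j - i); apply: walk_wlk hw ij. Qed.

Lemma reach_refl u : reach E u u.
Proof. by apply/reachP; exists 0. Qed.

Lemma reach_trans v u z : reach E u v -> reach E v z -> reach E u z.
Proof.
by move=> /reachP[k h] /reachP[l g]; apply/reachP; exists (k + l); apply: wlk_cat h g.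
Qed.

Lemma reach_edge u v : E u v -> reach E u v.
Proof. by move=> uv; apply/reachP; exists 1; apply/wlk1. Qed.

Lemma sc_refl u : sc u u. Proof. by split; apply: reach_refl. Qed.
Lemma sc_sym u v : sc u v -> sc v u. Proof. by case. Qed.
Lemma sc_trans v u z : sc u v -> sc v z -> sc u z.
Proof. by move=> [a b] [c e]; split; apply: reach_trans; eassumption. Qed.

Lemma scc_eq u v : sc u v -> scc u = scc v.
Proof.
move=> uv; apply/seteqP; split => x xu; first exact: sc_trans xu uv.
exact: sc_trans xu (sc_sym uv).
Qed.

Lemma cyc_sc u v : cyc u -> sc u v -> cyc v.
Proof.
move=> [k uu] [/reachP[a uv] /reachP[b vu]].
exists (b + k + a); have := wlk_cat vu (wlk_cat uu uv).
by rewrite addSn addnS addnA.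
Qed.

Lemma sc_neq_cyc u v : sc u v -> u <> v -> cyc u.
Proof.
move=> [/reachP[a uv] /reachP[b vu]] ne; exists (a + b).-1.
rewrite prednK; last by case: a uv => [/ne|a _].
exact: wlk_cat uv vu.
Qed.

Lemma cyc_next u : cyc u -> exists v, E u v /\ sc u v.
Proof.
move=> [k [v [uv vu]]]; exists v; split => //; split; first exact: reach_edge.
by apply/reachP; exists k.
Qed.

Lemma cyc_prev u : cyc u -> exists v, E v u /\ sc u v.
Proof.
move=> [k]; rewrite -addn1 => /wlk_split[v [uv /wlk1 vu]]; exists v; split => //.
by split; [apply/reachP; exists k | apply: reach_edge].
Qed.

Lemma edge_back_cyc u v : E u v -> reach E v u -> cyc u.
Proof. by move=> uv /reachP[k vu]; exists k, v. Qed.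

Lemma cyc_edge u v : E u v -> reach E v u -> cyc v.
Proof.
move=> uv vu; apply: cyc_sc (edge_back_cyc uv vu) _.
by split => //; apply: reach_edge.
Qed.

Lemma cyc_walk u : cyc u ->
  exists s, s 0 = u /\ forall i, E (s i) (s i.+1) /\ sc u (s i).
Proof.
move=> cu; have nx x : exists y, cyc x -> E x y /\ sc x y.
  have [cx|ncx] := EM (cyc x); last by exists x.
  by have [y h] := cyc_next cx; exists y.
have [F hF] := choice nx.
have h i : cyc (iter i F u) /\ sc u (iter i F u).
  elim: i => [|i [IH1 IH2]]; first by split => //; apply: sc_refl.
  have [_ e] := hF _ IH1; split; first exact: cyc_sc IH1 e.
  exact: sc_trans IH2 e.
exists (fun i => iter i F u); split => // i.
by have [h1 h2] := h i; have [? _] := hF _ h1.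
Qed.

Lemma walk_repeat_cyc w k i j : is_walk E w k -> i < j <= k -> w i = w j -> cyc (w i).
Proof.
move=> hw ij e; exists (j - i).-1; rewrite prednK; last by lia.
by rewrite [X in wlk _ _ X]e; apply: walk_wlk hw _; lia.
Qed.

(** A repeated vertex is cyclic and occurs at two indices. This is why parameters defined with paths
    can be computed with walks. *)
Lemma walk_path w k : is_walk E w k ->
  (forall i j, i < j <= k -> ~ (cyc (w i) /\ cyc (w j))) -> is_path E w k.
Proof.
move=> hw h; split => // i j ik jk e.
case: (ltngtP i j) => // ij; exfalso.
  have c : cyc (w i) by apply: (walk_repeat_cyc hw _ e); lia.
  by apply: (h i j); [lia | rewrite -e].
have c : cyc (w j) by apply: (walk_repeat_cyc hw _ (esym e)); lia.
by apply: (h j i); [lia | rewrite e].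
Qed.

Lemma reach_path u v : reach E u v ->
  exists w k, is_path E w k /\ w 0 = u /\ w k = v.
Proof.
move=> /reachP uv; have ne : exists k, (fun k => `[< wlk k u v >]) k.
  by have [k h] := uv; exists k; apply/asboolP.
case: (ex_minnP ne) => k /asboolP uvk min.
have [w [hw [w0 wk]]] := proj1 (wlkP _ _ _) uvk.
have lt i j : i < j <= k -> w i = w j -> False.
  move=> ij e; have h1 : wlk (i - 0) (w 0) (w i) by apply: (walk_wlk hw); lia.
  have h2 : wlk (k - j) (w j) (w k) by apply: (walk_wlk hw); lia.
  have /asboolP/min : wlk (i - 0 + (k - j)) u v.
    by rewrite -w0 -wk; apply: wlk_cat h1 _; rewrite e.
  by lia.
exists w, k; split => //; split => // i j ik jk e.
case: (ltngtP i j) => // ij; exfalso; first by apply: (lt i j _ e); lia.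
by apply: (lt j i _ (esym e)); lia.
Qed.

Lemma nontrivial_sccP K v : nontrivial_scc E K -> K v -> cyc v /\ K = scc v.
Proof.
move=> [[x eK] nt]; rewrite eK => vx.
have vx' : sc v x by [].
have exv : scc x = scc v by apply/esym/scc_eq.
split; last exact: exv.
apply: contrapT => ncv; apply: nt; split; first by exists x.
exists v; split; last by move=> /wlk1 vv; apply: ncv; exists 0.
rewrite eK; change (scc x = [set v]%classic); rewrite exv.
apply/seteqP; split => y /=; last by move=> ->; apply: sc_refl.
move=> yv; apply: contrapT => ne; apply: ncv.
by apply: (sc_neq_cyc (sc_sym yv)) => e; apply: ne.
Qed.

Lemma nontrivial_scc_cyc v : cyc v -> nontrivial_scc E (scc v).
Proof.
move=> cv; split; first by exists v.
move=> [_ [x [e nx]]]; have vx : v = x.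
  by have : scc v v := sc_refl v; rewrite e.
subst x; have [y [vy yv]] := cyc_next cv.
have : scc v y by apply: sc_sym.
by rewrite e => /= yv'; apply: nx; rewrite -{2}yv'.
Qed.

Lemma in_nontrivialP v : in_nontrivial_scc E v <-> cyc v.
Proof.
split=> [[K [ntK Kv]]|cv]; first by have [] := nontrivial_sccP ntK Kv.
by exists (scc v); split; [apply: nontrivial_scc_cyc | apply: sc_refl].
Qed.

Lemma in_trivialP v : in_trivial_scc E v <-> ~ cyc v.
Proof.
split=> [[K [[[x eK] [y [ey ny]]] Kv]] cv|ncv].
  have vy : v = y by move: Kv; rewrite ey.
  subst y; have [z [vz zv]] := cyc_next cv.
  have : K z by rewrite eK; apply: (sc_trans (sc_sym zv)); move: Kv; rewrite eK.
  by rewrite ey /= => e; apply: ny; rewrite -{2}e.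
exists (scc v); split; last exact: sc_refl.
apply: contrapT => nt; apply: ncv; apply/in_nontrivialP; exists (scc v).
split; last exact: sc_refl.
by split; first exists v.
Qed.

(* [K] is an [m]-whirl whose blocks are the fibres of [beta] modulo [m]. *)
Definition whirl_index K m (beta : V -> nat) :=
  0 < m /\
  (forall u v, K u -> K v -> (E u v <-> beta v = (beta u).+1 %[mod m])) /\
  (forall i, exists u, K u /\ beta u = i %[mod m]).

Lemma whirl_blocks_index K m B : whirl_blocks E K m B ->
  exists beta, whirl_index K m beta /\ forall i u, i < m -> B i u -> beta u = i.
Proof.
move=> [m0 [ne [sub [cov [disj ed]]]]].
have h u : exists i, K u -> i < m /\ B i u.
  have [Ku|nKu] := EM (K u); last by exists 0.
  by have [i hi] := cov u Ku; exists i.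
have [beta hb] := choice h.
have uni i u : i < m -> B i u -> beta u = i.
  move=> im Bu; have [bm Bb] := hb u (sub _ im _ Bu).
  exact: (disj _ _ u).
exists beta; split => //; split => //; split.
  move=> u v Ku Kv; have [bum Bu] := hb u Ku; have [bvm Bv] := hb v Kv.
  rewrite (ed _ _ Ku Kv); split.
    move=> [i [im [Biu Bv']]]; rewrite (uni _ _ im Biu) (uni _ _ _ Bv') ?ltn_pmod //.
    by rewrite modn_mod.
  move=> e; exists (beta u); split => //; split => //.
  by rewrite -e modn_small.
move=> i; have im : i %% m < m by rewrite ltn_pmod.
have [u Bu] := ne _ im; exists u; split; first exact: sub Bu.
by rewrite (uni _ _ im Bu) modn_mod.
Qed.

Lemma whirl_index_blocks K m beta : whirl_index K m beta ->
  whirl_blocks E K m (fun i => [set u | K u /\ beta u = i %[mod m]]%classic).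
Proof.
move=> [m0 [ed sur]]; split => //; split; first by move=> i _; apply: sur.
split; first by move=> i _ u [].
split.
  move=> u Ku; exists (beta u %% m); rewrite ltn_pmod //.
  by split => //=; rewrite modn_mod.
split.
  by move=> i j v im jm [_ e1] [_]; rewrite e1 !modn_small.
move=> u v Ku Kv; rewrite (ed _ _ Ku Kv); split.
  move=> e; exists (beta u %% m); rewrite ltn_pmod //; split => //; split => /=.
    by rewrite modn_mod.
  by split => //; rewrite e modn_mod -addn1 -[in RHS]addn1 modnDml.
move=> [i [im [/= [_ e1] [_ e2]]]]; rewrite e2 modn_mod -addn1 -[in RHS]addn1.
by rewrite -modnDml -e1 modnDml.
Qed.

Lemma whirl_section K m beta x : whirl_index K m beta -> K x ->
  exists e : nat -> V, (forall i, K (e i) /\ beta (e i) = i %[mod m]) /\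
    (forall i, i = beta x %[mod m] -> e i = x).
Proof.
move=> [m0 [ed sur]] Kx; have [e he] := choice sur.
exists (fun i => if i == beta x %[mod m] then x else e i); split.
  by move=> i; case: eqP => // ->.
by move=> i /eqP ->.
Qed.

Lemma whirl_edge K m beta u v : whirl_index K m beta -> K u -> K v ->
  beta v = (beta u).+1 %[mod m] -> E u v.
Proof. by move=> [_ [ed _]] Ku Kv /ed; apply. Qed.

Lemma whirl_edgeE K m beta u v : whirl_index K m beta -> K u -> K v ->
  E u v -> beta v = (beta u).+1 %[mod m].
Proof. by move=> [_ [ed _]] Ku Kv /ed; apply. Qed.

(** A walk winding around the whirl that is at [x] at time [N]; its periodicity allows a level to be
    replaced by a congruent one. *)
Lemma whirl_line K m beta x N : whirl_index K m beta -> K x ->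
  exists s, s N = x /\ (forall i, K (s i)) /\
    (forall i, beta (s i) + N = beta x + i %[mod m]) /\
    (forall i, E (s i) (s i.+1)) /\
    (forall i j, i = j %[mod m] -> s i = s j).
Proof.
move=> W Kx; have [e [he ex]] := whirl_section W Kx; have m0 : 0 < m by case: W.
(* [N * m.-1] is [- N] modulo [m], so [c i] stands for [beta x + i - N]; taking the remainder makes
   [s] literally periodic. *)
pose c i := (i + N * m.-1) %% m + beta x.
have ec i : c i + N = beta x + i %[mod m].
  rewrite /c -addnA modnDml addnC -!addnA; apply: (@eqmod_add1 m 0 (N * m)).
    by rewrite modnMl mod0n.
  by case: (m) m0 => // k _ /=; lia.
exists (fun i => e (c i)); split; last split; last split; last split.
- by apply: ex; apply: (eqmod_add1 (esym (ec N))); lia.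
- by move=> i; have [] := he (c i).
- by move=> i; have [_ h] := he (c i); apply: (eqmod_add2 (esym h) (esym (ec i))); lia.
- move=> i; have [k1 h1] := he (c i); have [k2 h2] := he (c i.+1).
  apply: (whirl_edge W k1 k2).
  by apply: (eqmod_add2 (eqmodD (esym h2) h1) (eqmodD (esym (ec i.+1)) (ec i))); lia.
- move=> i j ij; congr e; rewrite /c; congr (_ + _).
  by rewrite -modnDml ij modnDml.
Qed.

(* The period is the least [m > 0] that is congruent modulo [q] to the length of a
   closed walk at [v0]. *)
Lemma whirl_of_collapse q v0 : 0 < q -> cyc v0 ->
  (forall u v j, sc u v0 -> sc v v0 -> wlk (1 + j * q) u v -> E u v) ->
  exists m beta, whirl_index (scc v0) m beta.
Proof.
move=> q0 cv0 coll; pose Q l := exists k, wlk (l + k * q) v0 v0.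
have exm : exists m, (fun m => `[< 0 < m /\ Q m >]) m.
  exists q; apply/asboolP; split => //; have [c h] := cv0.
  by exists c; rewrite -mulSn mulnC; apply: wlk_rep.
case: (ex_minnP exm) => m /asboolP[m0 [km hm]] min.
have {q0}[p eq] : exists p, q = p.+1 by exists q.-1; rewrite prednK.
(* Modulo [q], going [p = q - 1] times around the closed walk for [m] amounts to removing it once.
   So [l] reduces to [l %% m], which is zero by minimality of [m]. *)
have Qdvd l : Q l -> m %| l.
  move=> [k hk]; have Qr : Q (l %% m).
    exists (k + (l %/ m) * m + (l %/ m) * p * km).
    have := wlk_cat hk (wlk_rep (l %/ m * p) hm).
    suff -> : l + k * q + l %/ m * p * (m + km * q)
      = l %% m + (k + l %/ m * m + l %/ m * p * km) * q by [].
    rewrite {1}(divn_eq l m) eq.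
    move: (l %/ m) (l %% m) => a b; ring.
  apply/negPn/negP; rewrite /dvdn -lt0n => r0.
  have /asboolP/min : 0 < l %% m /\ Q (l %% m) by [].
  by have := ltn_pmod l m0; lia.
have hb u : exists l, sc u v0 -> wlk l v0 u.
  have [uv|nuv] := EM (sc u v0); last by exists 0.
  by have [_ /reachP[l h]] := uv; exists l.
have [beta bP] := choice hb.
have Q0 l : wlk l v0 v0 -> l = 0 %[mod m].
  by move=> h; rewrite mod0n; apply/eqP/Qdvd; exists 0; rewrite addn0.
have uniq u a b : sc u v0 -> wlk a v0 u -> wlk b v0 u -> a = b %[mod m].
  move=> [/reachP[c uv] _] ha hb'.
  by apply: (eqmod_add2 (esym (Q0 _ (wlk_cat ha uv))) (Q0 _ (wlk_cat hb' uv))); lia.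
exists m, beta; split => //; split; last first.
  move=> i; have [s [s0 hs]] := cyc_walk cv0; exists (s i).
  have [_ si] := hs i; split; first exact: sc_sym.
  apply: (uniq (s i)); [exact: sc_sym | exact/bP/sc_sym |].
  by apply/wlkP; exists s; split => // j _; have [] := hs j.
move=> u v Ku Kv; split => [uv|e].
  apply: (uniq v _ _ Kv (bP v Kv)); rewrite -addn1.
  by apply: wlk_cat (bP u Ku) _; apply/wlk1.
(* The walk back to [v0] has positive length, so that [1] can be subtracted from [c + beta v]. *)
have [c [c0 hc]] : exists c, 0 < c /\ wlk c u v0.
  have [/reachP[c h] _] := Ku; have [c' h'] := cv0.
  by exists (c + c'.+1); split; [lia | apply: wlk_cat h h'].
have c1 : c + beta v = 1 %[mod m].
  have h := Q0 _ (wlk_cat (bP u Ku) hc).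
  by apply: (eqmod_add2 (esym h) (esym e)); lia.
have [r er] : exists r, c + beta v = 1 + r * m.
  have d1 : m %| c + beta v - 1 by rewrite -eqn_mod_dvd ?c1 //; lia.
  by exists ((c + beta v - 1) %/ m); rewrite divnK //; move: c0; clear; lia.
(* From [u] to [v0], then [r * p] times around the closed walk of length [m + km * q], then to [v]:
   the length is [1] modulo [q] because [r * m + r * p * m = r * m * q]. *)
apply: (coll u v (r * m + r * p * km) Ku Kv).
have := wlk_cat hc (wlk_cat (wlk_rep (r * p) hm) (bP v Kv)).
suff -> : c + (r * p * (m + km * q) + beta v) = 1 + (r * m + r * p * km) * q by [].
rewrite addnCA er eq; ring.
Qed.

End Graph.

(** * Gluing walks, first entry into a nontrivial component *)

Section GraphMore.
Context {V : Type} (E : V -> V -> Prop).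

Definition backward u := forall N, exists s, wlk E N s u.
Definition forward v := forall N, exists s, wlk E N v s.

Lemma cyc_back u N : cyc E u -> exists s, wlk E N s u /\ sc E s u.
Proof.
move=> cu; elim: N => [|N [s [su [h1 h2]]]]; first by exists u; split => //; apply: sc_refl.
have [x [xs sx]] := cyc_prev (cyc_sc cu (conj h2 h1)).
by exists x; split; [exists s | apply: sc_trans (sc_sym sx) (conj h1 h2)].
Qed.

Lemma cyc_backward u : cyc E u -> backward u.
Proof. by move=> cu N; have [s []] := cyc_back N cu; exists s. Qed.

Lemma cyc_forward u : cyc E u -> forward u.
Proof.
move=> cu N; have [s [s0 hs]] := cyc_walk cu; exists (s N); apply/wlkP; exists s; split => // i _.
by have [] := hs i.
Qed.

Lemma reach_forward u v : reach E u v -> forward v -> forward u.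
Proof.
move=> /reachP[k uv] fv N; have [s vs] := fv N.
have := wlk_cat uv vs; rewrite addnC => h; have [x [ux _]] := wlk_split h.
by exists x.
Qed.

Definition glue f N (s : nat -> V) i := if i < N then f i else s (i - N).

Lemma glue_edge f N s k : (forall i, i < N -> E (f i) (f i.+1)) -> f N = s 0 ->
  (forall i, i < k -> E (s i) (s i.+1)) ->
  forall i, i < N + k -> E (glue f N s i) (glue f N s i.+1).
Proof.
move=> hf e hs i ik; rewrite /glue; have [iN|Ni] := ltnP i N.
  have [iN'|] := ltnP i.+1 N; first exact: hf.
  move=> Ni; have eN : i.+1 = N by lia.
  by rewrite eN subnn -e -eN; apply: hf.
by rewrite ltnNge (leqW Ni) /= subSn //; apply: hs; lia.
Qed.

Lemma glue_edge_inf f N s : (forall i, i < N -> E (f i) (f i.+1)) -> f N = s 0 ->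
  (forall i, E (s i) (s i.+1)) ->
  forall i, E (glue f N s i) (glue f N s i.+1).
Proof. by move=> hf e hs i; apply: (@glue_edge _ _ _ i.+1) => //; lia. Qed.

Lemma glue_le f N s i : f N = s 0 -> i <= N -> glue f N s i = f i.
Proof.
rewrite /glue => e; rewrite leq_eqVlt => /orP[/eqP->|->//].
by rewrite ltnn subnn.
Qed.

Lemma glue_ge f N s i : N <= i -> glue f N s i = s (i - N).
Proof. by rewrite /glue leqNgt => /negbTE ->. Qed.

Lemma cyc_line u N : cyc E u ->
  exists s, s N = u /\ forall i, E (s i) (s i.+1) /\ sc E u (s i).
Proof.
move=> cu; have [x [xu scx]] := cyc_back N cu.
have [f [hf [f0 fN]]] := proj1 (wlkP _ _ _ _) xu.
have [s [s0 hs]] := cyc_walk cu.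
have e : f N = s 0 by rewrite fN s0.
exists (glue f N s); split; first by rewrite glue_le.
move=> i; split; first by apply: glue_edge_inf => // j; have [] := hs j.
have [iN|Ni] := leqP i N; last by rewrite glue_ge; [exact: (proj2 (hs _)) | lia].
rewrite glue_le //; split.
  apply: reach_trans (proj2 scx) _; rewrite -f0.
  by apply: (walk_reach hf); lia.
by rewrite -fN; apply: (walk_reach hf); lia.
Qed.

Lemma segment_reach (g : nat -> V) lo hi i j :
  (forall i, lo <= i < hi -> E (g i) (g i.+1)) -> lo <= i -> i <= j -> j <= hi ->
  reach E (g i) (g j).
Proof.
move=> hg loi ij jhi; have hw : is_walk E (fun k => g (i + k)) (j - i).
  by move=> k hk; rewrite addnS; apply: hg; lia.
have := walk_reach hw (i := 0) (j := j - i).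
by rewrite addn0 subnKC //; apply; lia.
Qed.

(** An edge that does not go forward along the walk closes a cycle through its end. For maps that
    follow a walk by depth, this turns edges of one tree into inequalities between depths in the
    other. *)
Lemma segment_edge_lt (g : nat -> V) lo hi i j :
  (forall i, lo <= i < hi -> E (g i) (g i.+1)) -> lo <= i <= hi -> lo <= j <= hi ->
  ~ cyc E (g j) -> E (g i) (g j) -> i < j.
Proof.
move=> hg hi' hj nc e; rewrite ltnNge; apply/negP => ji; apply: nc.
by apply: (cyc_edge e); apply: (segment_reach hg); lia.
Qed.

Lemma between_cyc u v x : cyc E u -> reach E u v -> reach E v x -> reach E x u ->
  cyc E v.
Proof.
move=> cu uv vx xu; apply: (cyc_sc cu); split => //.
exact: reach_trans vx xu.
Qed.

Definition scc_isolated := forall u v, cyc E u -> cyc E v -> reach E u v -> reach E v u.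

Definition entry w l := is_walk E w l /\ (forall i, i < l -> ~ cyc E (w i)) /\ cyc E (w l).

Lemma first_entry w k : is_walk E w k -> cyc E (w k) -> exists2 l, l <= k & entry w l.
Proof.
move=> hw ck; have ex : exists i, (fun i => (i <= k) && `[< cyc E (w i) >]) i.
  by exists k; rewrite leqnn; apply/asboolP.
case: (ex_minnP ex) => l /andP[lk /asboolP cl] min; exists l => //; split.
  by move=> i il; apply: hw; lia.
split => // i il ci; have /min : (i <= k) && `[< cyc E (w i) >].
  by rewrite (leq_trans (ltnW il) lk); apply/asboolP.
by lia.
Qed.

(** The prolonged walk meets a cyclic vertex by time [N]. Isolation puts it in the component of [x],
    and [W N], lying between the two, would be cyclic as well. *)
Lemma no_late_entry N W x : scc_isolated -> (forall w l, entry w l -> l <= N) ->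
  is_walk E W N -> ~ cyc E (W N) -> reach E (W N) x -> ~ cyc E x.
Proof.
move=> iso hN hW nc [p [k [hp [p0 pk]]]] cx.
have e : W N = p 0 by rewrite p0.
have hw : is_walk E (glue W N p) (N + k) by move=> i ik; apply: glue_edge ik.
have gk : glue W N p (N + k) = x by rewrite glue_ge ?addKn //; lia.
have ck : cyc E (glue W N p (N + k)) by rewrite gk.
have [l lk [h1 [h2 h3]]] := first_entry hw ck.
have lN : l <= N by apply: (hN (glue W N p)).
apply: nc; have r1 : reach E (glue W N p l) (W N).
  rewrite -(glue_le e (leqnn N)); apply: (walk_reach hw); lia.
apply: (between_cyc (x := x) h3 r1); first by exists p, k.
by apply: (iso _ _ h3 cx); apply: (reach_trans r1); exists p, k.
Qed.

End GraphMore.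

(** * Homomorphisms from trees *)

Section Hom.
Context {V : Type} (E : V -> V -> Prop) (n : nat).
Implicit Types (d : nat -> nat).

Definition tree_hom d (phi : nat -> V) :=
  forall x, 0 < x < n -> E (phi (par d x)) (phi x).

Lemma level_hom d w N : depthseq n d -> is_walk E w N -> (forall x, x < n -> d x <= N) ->
  tree_hom d (fun x => w (d x)).
Proof.
move=> dT hw dN x hx; have [h1 h2 _] := parP dT hx.
by rewrite h2; apply: hw; have := dN x; lia.
Qed.

Definition branch d x (phi : nat -> V) g y := if anc d x y then g (d y) else phi y.

Lemma branch_hom d x phi g : depthseq n d -> x < n ->
  (forall y, 0 < y < n -> ~~ anc d x y -> E (phi (par d y)) (phi y)) ->
  (0 < x -> E (phi (par d x)) (g (d x))) ->
  (forall i, d x <= i < d x + hgt n d x -> E (g i) (g i.+1)) ->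
  tree_hom d (branch d x phi g).
Proof.
move=> dT xn h1 h2 h3 y hy; have [py dy ay] := parP dT hy; rewrite /branch.
have yn : y < n by lia.
have [xy|nxy] := boolP (anc d x y).
  have [e|ne] := eqVneq x y.
    rewrite -e in py dy ay hy *; rewrite ifN; first by apply: h2; lia.
    by apply/negP => /(anc_leq dT); lia.
  have a := anc_par dT yn xy ne; rewrite a dy; apply: h3.
  have := anc_depth dT a; have := hgt_ge yn xy; lia.
rewrite ifN; last by apply: contra nxy => a; apply: (anc_trans dT) a ay.
exact: h1.
Qed.

Lemma branch_level_hom d x F g : depthseq n d -> x < n ->
  (forall i, E (F i) (F i.+1)) ->
  (0 < x -> E (F (d x).-1) (g (d x))) ->
  (forall i, d x <= i < d x + hgt n d x -> E (g i) (g i.+1)) ->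
  tree_hom d (branch d x (fun y => F (d y)) g).
Proof.
move=> dT xn hF h2 h3; apply: branch_hom => //.
  by move=> y hy _; rewrite (par_depth dT hy).
move=> x0; have hx : 0 < x < n by rewrite x0.
by move: (h2 x0); rewrite {1}(par_depth dT hx).
Qed.

(** The parent of [x] in the second tree precedes [x], so it lies outside the redirected subtree and
    keeps its value under [phi]. *)
Lemma branch_cut d d' x phi g : depthseq n d -> depthseq n d' -> 0 < x < n ->
  tree_hom d' (branch d x phi g) -> E (phi (par d' x)) (g (d x)).
Proof.
move=> dT dT' hx /(_ x hx); rewrite /branch (anc_refl dT) ifN //.
by apply/negP => /(anc_leq dT); have := par_lt dT' hx; lia.
Qed.

Section OneSided.
Context (d d' : nat -> nat) (dT : depthseq n d) (dT' : depthseq n d').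
Hypothesis dd' : forall phi, tree_hom d phi -> tree_hom d' phi.

Lemma collapse_at z u v : 0 < z < n -> (forall y, y < z -> d y = d' y) ->
  d' z < d z -> backward E u -> forward E v ->
  wlk E (d z - d' z).+1 u v -> E u v.
Proof.
move=> hz eqz lt bu fv uv.
have d'z := depth_gt0 dT' hz.
have [s su] := bu (d' z).-1; have [e ve] := fv n.
have [w1 [hw1 [w10 w1e]]] := proj1 (wlkP _ _ _ _) su.
have [w2 [hw2 [w20 w2e]]] := proj1 (wlkP _ _ _ _) uv.
have [w3 [hw3 [w30 w3e]]] := proj1 (wlkP _ _ _ _) ve.
have eW : w2 (d z - d' z).+1 = w3 0 by rewrite w2e w30.
pose W := glue w2 (d z - d' z).+1 w3.
have eg3 : w1 (d' z).-1 = W 0 by rewrite w1e /W glue_le.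
(* Level [d' z - 1] carries [u] and level [d z] carries [v]. The parent of [z] in the second tree
   precedes [z], so it has depth [d' z - 1] in both trees. *)
have hw : is_walk E (glue w1 (d' z).-1 W) ((d' z).-1 + ((d z - d' z).+1 + n)).
  by move=> i ik; apply: glue_edge ik => // j jk; apply: glue_edge jk.
have := dd' (level_hom dT hw _); move/(_ _ z hz).
have [p1 p2 _] := parP dT' hz.
have -> : d (par d' z) = (d' z).-1 by rewrite eqz //; lia.
rewrite glue_le // w1e glue_ge; last by lia.
have -> : d z - (d' z).-1 = (d z - d' z).+1 by lia.
rewrite /W glue_le // w2e; apply.
by move=> x xn; have := depth_leq dT xn; lia.
Qed.

(** A walk around the whirl, taken by depth, sends [x] to index [d x]. Each edge of the second tree
    raises the index by one, so the index is also [d' x]. *)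
Lemma whirl_depth K m beta : whirl_index E K m beta ->
  forall x, x < n -> d x = d' x %[mod m].
Proof.
move=> W; have [m0 [ed sur]] := W; have [e he] := choice sur.
have hw : is_walk E e n.
  move=> i _; have [k1 h1] := he i; have [k2 h2] := he i.+1.
  by apply: (whirl_edge W k1 k2); apply: (eqmod_add2 (esym h2) h1); lia.
have := dd' (level_hom dT hw (fun x xn => leq_trans (depth_leq dT xn) (ltnW xn))).
move=> hh; elim/ltn_ind => x IH xn.
have [->|x0] := eqVneq x 0; first by rewrite (proj1 dT) (proj1 dT').
have hx : 0 < x < n by lia.
have [p1 p2 _] := parP dT' hx.
have [k1 h1] := he (d (par d' x)); have [k2 h2] := he (d x).
have := whirl_edgeE W k1 k2 (hh x hx) => h3.
have h4 := IH _ p1 (ltn_trans p1 xn).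
apply: (eqmod_add2 (eqmodD h2 (esym h1)) (eqmodD (esym h3) (esym h4))).
by rewrite p2; clear; lia.
Qed.

(** [T_x] is sent to the component of [v] and the rest to that of [u]; an edge of the second tree
    leaving [T_x] would lead back from [v] to [u]. *)
Lemma branch_sets u v : cyc E u -> cyc E v -> E u v -> ~ reach E v u ->
  forall x y, x < n -> y < n -> anc d' x y -> anc d x y.
Proof.
move=> cu cv uv nvu x y xn.
have [F [FN hF]] := cyc_line (d x).-1 cu; have [s [s0 hs]] := cyc_walk cv.
pose g i := s (i - d x).
have : tree_hom d' (branch d x (fun y => F (d y)) g).
  apply/dd'/branch_level_hom => //; first by move=> i; exact: (proj1 (hF i)).
    by move=> _; rewrite FN /g subnn s0.
  move=> i hi; rewrite /g subSn; first exact: (proj1 (hs _)).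
  by case/andP: hi.
move=> hh; move: y; apply: (anc_ind dT'); first exact: (anc_refl dT).
move=> y yn xy' xy a' a; apply: contrapT => /negP na.
have hy : 0 < y < n by lia.
have := hh y hy; rewrite /branch a (negbTE na) => e; apply: nvu.
apply: reach_trans (proj1 (proj2 (hs (d (par d' y) - d x)))) _.
exact: reach_trans (reach_edge e) (proj2 (proj2 (hF (d y)))).
Qed.

Lemma pleasant_depth w k : is_walk E w k -> (forall i, i <= k -> ~ cyc E (w i)) ->
  hgt n d 0 <= k -> forall x, x < n -> d' x <= d x.
Proof.
move=> hw nc hk.
have dk x : x < n -> d x <= k.
  move=> xn; apply: leq_trans hk.
  by have := hgt_ge xn (anc0 dT xn); rewrite (proj1 dT).
have hh := dd' (level_hom dT hw dk).
elim/ltn_ind => x IH xn.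
have [->|x0] := eqVneq x 0; first by rewrite (proj1 dT').
have hx : 0 < x < n by lia.
have [p1 p2 _] := parP dT' hx; have pn : par d' x < n by lia.
have := hh x hx => e.
have : d (par d' x) < d x.
  apply: (@segment_edge_lt _ E w 0 k _ _ _ _ _ _ e); rewrite ?leq0n ?dk //.
  exact/nc/dk.
by have := IH _ p1 pn; lia.
Qed.

(* Hanging a pleasant walk [g] at [x] shows that every descendant of [x] in
   the second tree is one in the first, and is not deeper there. *)
Lemma branch_descend x F g h : x < n -> (forall i, E (F i) (F i.+1)) ->
  hgt n d x <= h -> is_walk E g h -> (forall i, i <= h -> ~ cyc E (g i)) ->
  (0 < x -> E (F (d x).-1) (g 0)) ->
  (forall i y, i <= h -> y < n -> anc d' x y -> ~~ anc d x y -> ~ E (g i) (F (d y))) ->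
  forall y, y < n -> anc d' x y -> anc d x y /\ d' y + d x <= d y + d' x.
Proof.
move=> xn hF hh hg nc xg nE.
have : tree_hom d' (branch d x (fun y => F (d y)) (fun i => g (i - d x))).
  apply/dd'/branch_level_hom => //; first by rewrite subnn.
  by move=> i hi; rewrite subSn; [apply: hg; lia | lia].
move=> hm; apply: (anc_ind dT'); first by rewrite (anc_refl dT); split => //; lia.
move=> y yn xy' xy a' [a le]; have hy : 0 < y < n by lia.
have [p1 p2 _] := parP dT' hy; have pn : par d' y < n by lia.
have hp := hgt_ge pn a; have lp := anc_depth dT a.
have := hm y hy; rewrite /branch a; case: ifPn => [xy1|nxy] e; last first.
  by case: (nE (d (par d' y) - d x) y) => //; lia.
have hy' := hgt_ge yn xy1; have ly := anc_depth dT xy1.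
split => //.
have : d (par d' y) - d x < d y - d x; last by lia.
apply: (@segment_edge_lt _ E g 0 h _ _ _ _ _ _ e); try lia.
  by move=> i hi; apply: hg.
by apply: nc; lia.
Qed.

End OneSided.
End Hom.

(** * Necessity *)

Section GraphParameters.
Context {V : Type} (E : V -> V -> Prop).
Implicit Types (l m r e : nat).

(** This and the next definitions restate the graph parameters with [cyc] and walks in place of
    nontrivial components and paths. *)
Definition pleasant w k := is_walk E w k /\ forall i, i <= k -> ~ cyc E (w i).

Definition outlet g l :=
  is_walk E g l /\ cyc E (g 0) /\ forall i, 0 < i <= l -> ~ cyc E (g i).

Definition in_ZG m := exists (K : set V) p beta u w f,
  is_scc E K /\ whirl_index E K p beta /\ K u /\ K w /\ beta u = beta w %[mod p] /\
  is_walk E f m.+1 /\ f 0 = u /\ ~ E w (f 1).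

Definition in_BG m := exists f a b,
  is_walk E f m /\ E (f m) a /\ E (f m) b /\ cyc E a /\ cyc E b /\ ~ sc E a b.

Definition in_omegaG l r m := exists f g,
  is_walk E f l /\ cyc E (f l) /\ g r.-1 = f r.-1 /\
  (forall i, r.-1 <= i < m -> E (g i) (g i.+1)) /\ l <= m /\ ~ cyc E (g l).

Definition in_lambdaG e m := exists u w v,
  entry E u e /\ sc E w (u e) /\ E w (u e) /\ is_walk E v m /\
  (E w (v 0) <-> ~ E (u e.-1) (v 0)).

End GraphParameters.

Section OneSided.
Context {V : Type} (E : V -> V -> Prop) (n : nat).
Context (d d' : nat -> nat) (dT : depthseq n d) (dT' : depthseq n d').
Hypothesis dd' : forall phi, tree_hom E n d phi -> tree_hom E n d' phi.
Variable L : nat.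
Hypothesis lev : forall x, x < n -> d x <= L \/ d' x <= L -> d x = d' x.

Lemma lev_gt x : x < n -> (L < d x) = (L < d' x).
Proof. by move=> xn; rewrite !ltnNge (lev_leq lev). Qed.

Lemma deep_parent x : x < n -> d x = L.+1 -> d' x <> L.+1 ->
  [/\ 0 < x < n, L.+1 < d' x, par d' x < n & L < d (par d' x)].
Proof.
move=> xn dx dx'; have hx : 0 < x < n.
  by rewrite xn andbT lt0n; apply/eqP => e; move: dx; rewrite e (proj1 dT).
have d'x : L < d' x by rewrite -lev_gt // dx.
have [p1 p2 _] := parP dT' hx; split => //; [lia|lia|].
by rewrite lev_gt; lia.
Qed.

Lemma entry_le x w l : x < n -> d x = L.+1 -> d' x <> L.+1 ->
  entry E w l -> l <= L.+1.
Proof.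
move=> xn dx dx' [hw [nc cl]]; rewrite leqNgt; apply/negP => lL.
have [hx d'x pn term_depth] := deep_parent xn dx dx'.
have [s [s0 hs]] := cyc_walk cl.
(* Only the last [L + 2] steps are kept: level [L + 1] then carries the last noncyclic vertex of the
   entry, and an edge into it from level [L + 1] or deeper would make it cyclic. *)
pose f i := w (l - L.+2 + i).
have hf i : i < L.+2 -> E (f i) (f i.+1).
  by move=> iL; rewrite /f addnS; apply: hw; lia.
have e : f L.+2 = s 0 by rewrite s0 /f; congr w; lia.
have hF := glue_edge_inf hf e (fun i => proj1 (hs i)).
have hFn : is_walk E (glue f L.+2 s) n by move=> i _; apply: hF.
have := dd' (level_hom dT hFn (fun y yn => leq_trans (depth_leq dT yn) (ltnW yn))).
move=> /(_ x hx); rewrite dx => eb.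
have fL : glue f L.+2 s L.+1 = f L.+1 by rewrite glue_le.
apply: (nc (l - L.+2 + L.+1)); first lia.
rewrite -/(f L.+1) -fL; apply: (cyc_edge eb).
by apply: (@segment_reach _ E _ 0 (d (par d' x))) => // i _; apply: hF.
Qed.

(** Everything outside [T_x] stays in the component that the outlet leaves; an edge from the outlet
    back to it would make a vertex of the outlet cyclic. *)
Lemma outlet_descend g l x : outlet E g l.+1 -> x < n -> hgt n d x <= l ->
  forall y, y < n -> anc d' x y -> anc d x y /\ d' y + d x <= d y + d' x.
Proof.
move=> [hg [c0 nc]] xn hl; have [F [FN hF]] := cyc_line (d x).-1 c0.
apply: (branch_descend dT dT' dd' (F := F) (g := fun i => g i.+1) (h := l)) => //.
- by move=> i; exact: (proj1 (hF i)).
- by move=> i il; apply: hg.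
- by move=> i il; apply: nc; lia.
- by move=> _; rewrite FN; apply: hg.
move=> i y il yn _ _ e; apply: (nc i.+1); first lia.
have r0 : reach E (g 0) (g i.+1) by apply: (walk_reach hg); lia.
exact: (between_cyc c0 r0 (reach_edge e) (proj2 (proj2 (hF _)))).
Qed.

(** If the walk were as long as [T_x] is high, the two parents of [x] could be sent to [u] and [w]
    in one block and [T_x] along the walk; the second tree would demand the missing edge from
    [w]. *)
Lemma in_ZG_lt m x : in_ZG E m -> 0 < x < n -> par d x <> par d' x ->
  m < hgt n d x.
Proof.
move=> [K [p [beta [u [w [f [_ [W [Ku [Kw [buw [hf [f0 nE]]]]]]]]]]]]] hx np.
rewrite ltnNge; apply/negP => hm; have p0 : 0 < p by case: W.
have cong := whirl_depth dT dT' dd' W.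
have [e [he _]] := whirl_section W Ku.
(* [c] stands for [beta u - d (par d x)] modulo [p], so that level [d (par d x)] receives the block
   of [u]. *)
pose c := beta u + d (par d x) * p.-1.
have hc : d (par d x) + c = beta u %[mod p].
  have -> : d (par d x) + c = d (par d x) * p + beta u.
    by rewrite /c addnCA addnC -mulnS prednK.
  by rewrite modnMDl.
have [q1 q2 _] := parP dT' hx; have [o1 o2 _] := parP dT hx.
have qn : par d' x < n by lia.
have xn : x < n by case/andP: hx.
have term_depth : d (par d' x) = d (par d x) %[mod p].
  apply: (eqmod_add2 (esym (cong _ qn)) (cong x xn)).
  by rewrite q2 o2; clear; lia.
pose phi y := if y == par d x then u else if y == par d' x then w else e (d y + c).
have hphi y : K (phi y) /\ beta (phi y) = d y + c %[mod p].
  rewrite /phi; case: eqP => [->|_]; first by rewrite hc.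
  case: eqP => [->|_ //]; split => //; rewrite -buw -hc.
  by rewrite -modnDml -term_depth modnDml.
have ephi y : 0 < y < n -> E (phi (par d y)) (phi y).
  move=> hy; have [k1 h1] := hphi (par d y); have [k2 h2] := hphi y.
  apply: (whirl_edge W k1 k2); apply: (eqmod_add2 (esym h2) h1).
  by rewrite {1}(par_depth dT hy); clear; lia.
have hm1 : tree_hom E n d (branch d x phi (fun i => f (i - d x).+1)).
  apply: branch_hom => //; first by move=> y hy _; exact: ephi.
    by move=> _; rewrite /phi eqxx -f0 subnn; apply: hf.
  move=> i hi; rewrite subSn; last by case/andP: hi.
  by apply: hf; move: hi hm; clear; lia.
have := branch_cut dT dT' hx (dd' hm1).
by rewrite /phi eqxx subnn ifN //; apply/eqP => h; apply: np.
Qed.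

(** The last [L] steps of the walk put the fork at level [L]. Deeper levels follow the component of
    [a], except [T_x], which goes to that of [b]; the second parent of [x] is deeper than [L], so an
    edge joins the two components. *)
Lemma in_BG_lt m x : scc_isolated E -> x < n -> d x = L.+1 -> d' x <> L.+1 ->
  in_BG E m -> m < L.
Proof.
move=> iso xn dx dx' [f [a [b [hf [fa [fb [ca [cb nab]]]]]]]].
rewrite ltnNge; apply/negP => Lm.
have [hx d'x pn term_depth] := deep_parent xn dx dx'.
have [sa [sa0 hsa]] := cyc_walk ca; have [sb [sb0 hsb]] := cyc_walk cb.
pose f' i := f (m - L + i).
have hf' i : i < L -> E (f' i) (f' i.+1).
  by move=> iL; rewrite /f' addnS; apply: hf; lia.
pose s i := if i is j.+1 then sa j else f m.
have e : f' L = s 0 by rewrite /f' /= subnK.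
have hs i : E (s i) (s i.+1) by case: i => [|i] /=; [rewrite sa0 | case: (hsa i)].
have hF := glue_edge_inf hf' e hs.
have hm1 : tree_hom E n d (branch d x (fun y => glue f' L s (d y)) (fun i => sb (i - d x))).
  apply: branch_level_hom => //.
    by move=> _; rewrite dx glue_le // e subnn sb0.
  by move=> i hi; rewrite subSn; [case: (hsb (i - d x)) | lia].
have := branch_cut dT dT' hx (dd' hm1); rewrite subnn sb0 glue_ge; last by lia.
case ej : (d (par d' x) - L) => [|j] /=; first by move: ej term_depth; lia.
move=> eab; apply: nab; have rab : reach E a b.
  exact: reach_trans (proj1 (proj2 (hsa j))) (reach_edge eab).
by split => //; apply: iso.
Qed.

(** [T_x] follows [F] before level [r] and [g] from there on. The trees agree up to depth [L];
    beyond it [g] avoids cycles, so edges of the second tree must go forward along [g]. *)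
Lemma omega_shallow x F g r m : x < n -> d x <= L -> d x <= r -> 0 < r <= L.+1 ->
  L < m -> (forall i, E (F i) (F i.+1)) -> g r.-1 = F r.-1 ->
  (forall i, r.-1 <= i < m -> E (g i) (g i.+1)) ->
  (forall i, L < i <= m -> ~ cyc E (g i)) ->
  d x + hgt n d x <= m ->
  forall y, y < n -> anc d' x y -> d' y <= d y.
Proof.
move=> xn dxL dxr hr Lm hF eg hg nc hm.
pose G i := if i < r then F i else g i.
have hG i : i < m -> E (G i) (G i.+1).
  move=> im; rewrite /G; have [ir|ri] := ltnP i.+1 r; first by rewrite ltnW.
  have [ir'|ri'] := ltnP i r; last by apply: hg; lia.
  have -> : i = r.-1 by lia.
  by rewrite -eg; apply: hg; lia.
have GF i : i < r -> G i = F i by rewrite /G => ->.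
have Gg i : L < i -> G i = g i by rewrite /G => Li; rewrite ifN //; lia.
have hm1 : tree_hom E n d (branch d x (fun y => F (d y)) G).
  apply: branch_level_hom => //; last by move=> i hi; apply: hG; lia.
  move=> x0; have dx0 := depth_gt0 dT (introT andP (conj x0 xn)).
  have -> : F (d x).-1 = G (d x).-1 by rewrite GF //; lia.
  by rewrite -{2}(prednK dx0); apply: hG; lia.
have hh := dd' hm1; apply: (anc_ind dT'); first by rewrite lev //; left.
move=> y yn xy' xy a' le; have hy : 0 < y < n by lia.
have [p1 p2 _] := parP dT' hy; have pn : par d' y < n by lia.
have [dyL|dyL] := leqP (d y) L; first by rewrite lev //; left.
have [pL|pL] := leqP (d' (par d' y)) L; first lia.
have an : anc d x y by rewrite (lev_anc lev).
have anp : anc d x (par d' y) by rewrite (lev_anc lev).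
have pL' : L < d (par d' y) by rewrite lev_gt.
have := hh y hy; rewrite /branch an anp !Gg // => e.
have hy1 := hgt_ge yn an; have hy2 := hgt_ge pn anp.
suff : d (par d' y) < d y by lia.
apply: (@segment_edge_lt _ E g r.-1 m _ _ _ _ _ _ e) => //; try lia.
by apply: nc; lia.
Qed.

(** In the second tree [x] is deeper than [L + 1], so its neighbours are mapped into the whirl and
    its image may be exchanged for any [k] of the same block. In the first tree its parent is at
    [u L]. *)
Lemma entry_whole_block u k p beta x : (forall phi, tree_hom E n d' phi -> tree_hom E n d phi) ->
  x < n -> d x = L.+1 -> d' x <> L.+1 -> entry E u L.+1 ->
  whirl_index E (scc E (u L.+1)) p beta -> sc E k (u L.+1) ->
  beta k = beta (u L.+1) %[mod p] -> E (u L) k.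
Proof.
move=> d'd xn dx dx' [hu [_ cu]] W Kk bk.
have [hx d'x pn term_depth] := deep_parent xn dx dx'.
have pL : d' (par d x) = L.
  have o2 := par_depth dT hx; have o1 := par_lt dT hx.
  by rewrite -lev; [lia | lia | left; lia].
have cong := whirl_depth dT dT' dd' W.
have Kk' : scc E (u L.+1) k by [].
have [s [sN [Ks [bs [Es _]]]]] := whirl_line L.+1 W (sc_refl E (u L.+1)).
pose F := glue u L.+1 (fun i => s (i + L.+1)).
have hF : forall i, E (F i) (F i.+1).
  by apply: glue_edge_inf => // i; rewrite addSn.
have FL i : L < i -> F i = s i by move=> Li; rewrite /F glue_ge // subnK.
pose psi y := if y == x then k else F (d' y).
have hpsi : tree_hom E n d' psi.
  move=> y hy; have [p1 p2 _] := parP dT' hy; rewrite /psi.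
  case: (eqVneq y x) => [eyx|nyx].
    subst y; rewrite ifN; last by rewrite neq_ltn p1.
    rewrite FL; last by move: d'x p2; clear; lia.
    apply: (whirl_edge W (Ks _) Kk'); rewrite bk.
    apply: (eqmod_add2 (esym (cong x xn)) (bs (d' (par d' x)))).
    by rewrite dx p2; clear; lia.
  case: (eqVneq (par d' y) x) => [epx|npx]; last by rewrite p2.
  rewrite FL; last by rewrite p2 epx; move: d'x; clear; lia.
  apply: (whirl_edge W Kk' (Ks _)).
  apply: (eqmod_add3 bk (esym (bs (d' y))) (cong x xn)).
  by rewrite dx p2 epx; clear; lia.
have := d'd _ hpsi x hx; rewrite /psi eqxx ifN; last first.
  by rewrite neq_ltn (par_lt dT hx).
by rewrite pL /F glue_le // add0n sN.
Qed.

Lemma in_lambdaG_lt x m : (forall phi, tree_hom E n d' phi -> tree_hom E n d phi) ->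
  (forall v, cyc E v -> exists p beta, whirl_index E (scc E v) p beta) ->
  x < n -> d x = L.+1 -> d' x <> L.+1 -> in_lambdaG E L.+1 m ->
  m < maxn (hgt n d x) (hgt n d' x).
Proof.
move=> d'd wh xn dx dx' [u [w [v [en [Kw [wu [hv wv]]]]]]].
rewrite ltnNge; apply/negP => hm.
have [p [beta W]] := wh _ (proj2 (proj2 en)).
have hu := proj1 en.
have cC := entry_whole_block d'd xn dx dx' en W.
have [hx d'x pn term_depth] := deep_parent xn dx dx'.
have pL : d' (par d x) = L.
  have o2 := par_depth dT hx; have o1 := par_lt dT hx.
  by rewrite -lev; [lia | lia | left; lia].
have cong := whirl_depth dT dT' dd' W.
have Kw' : scc E (u L.+1) w by [].
have bw := whirl_edgeE W Kw' (sc_refl E (u L.+1)) wu.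
(* By [cC] the entry may continue at any vertex of the block it enters; the continuation is chosen
   so that levels beyond [L] congruent to [L] go to [w]. *)
have [e [he ew]] := whirl_section W Kw'.
pose F := glue u L.+1 (fun i => e (beta (u L.+1) + i)).
have FL i : L < i -> F i = e (beta (u L.+1) + (i - L.+1)).
  by move=> Li; rewrite /F glue_ge.
have FlL i : i <= L -> F i = u i by move=> iL; rewrite /F /glue ltnS iL.
have hF i : E (F i) (F i.+1).
  case: (ltngtP i L) => [iL|Li|->].
  - by rewrite !FlL ?(ltnW iL) //; apply: hu; exact: leqW.
  - rewrite (FL _ Li) (FL _ (leqW Li)).
    have [k1 h1] := he (beta (u L.+1) + (i - L.+1)).
    have [k2 h2] := he (beta (u L.+1) + (i.+1 - L.+1)).
    apply: (whirl_edge W k1 k2); apply: (eqmod_add2 (esym h2) h1).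
    by move: Li; clear; lia.
  - rewrite FlL // FL // subnn addn0; have [k1 h1] := he (beta (u L.+1)).
    exact: cC.
have Fw i : L < i -> i = L %[mod p] -> F i = w.
  move=> Li iL; rewrite FL //; apply: ew; apply: (eqmod_add2 (esym bw) (esym iL)).
  by move: Li; clear; lia.
have xL := cong x xn.
have [p1 p2 _] := parP dT' hx; have o2 := par_depth dT hx.
have Fp1 : F (d (par d' x)) = w.
  apply: Fw => //; apply: (eqmod_add2 xL (esym (cong _ pn))).
  by rewrite dx p2; clear; lia.
have Fp2 : F (d' x).-1 = w.
  apply: Fw; first by move: d'x; clear; lia.
  by apply: (eqmod_add1 xL); rewrite dx p2; clear; lia.
(* The parent of [x] goes to [u L] in the first tree and to [w] in the second; [v] is hung on the
   tree where it can start. *)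
have [uv|nuv] := EM (E (u L) (v 0)).
  have hm1 : tree_hom E n d (branch d x (fun y => F (d y)) (fun i => v (i - d x))).
    apply: branch_level_hom => //; first by rewrite subnn dx /= FlL.
    move=> i hi; rewrite subSn; last by case/andP: hi.
    apply: hv; move: hm hi; rewrite geq_max; clear; lia.
  have := branch_cut dT dT' hx (dd' hm1); rewrite subnn Fp1.
  by move/wv; apply.
have hm1 : tree_hom E n d' (branch d' x (fun y => F (d' y)) (fun i => v (i - d' x))).
  apply: branch_level_hom => //; first by rewrite subnn Fp2 => _; apply/wv.
  move=> i hi; rewrite subSn; last by case/andP: hi.
  apply: hv; move: hm hi; rewrite geq_max; clear; lia.
have := branch_cut dT' dT hx (d'd _ hm1); rewrite subnn.
by rewrite pL FlL.
Qed.

End OneSided.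

Lemma first_difference n (d d' : nat -> nat) : depthseq n d -> depthseq n d' ->
  (exists2 x, x < n & d x <> d' x) ->
  exists z, [/\ 0 < z < n, d z <> d' z & forall y, y < z -> d y = d' y].
Proof.
move=> dT dT' [x xn dx]; have ex : exists z, (fun z => (z < n) && (d z != d' z)) z.
  by exists x; rewrite xn; apply/eqP.
case: (ex_minnP ex) => z /andP[zn /eqP dz] min; exists z; split => //.
  by rewrite zn andbT lt0n; apply/eqP => e; apply: dz; rewrite e (proj1 dT) (proj1 dT').
move=> y yz; apply/eqP/negPn/negP => ne.
by have := min y; rewrite ne (ltn_trans yz zn) => /(_ isT); lia.
Qed.

Lemma anc_depths n (d d' : nat -> nat) : depthseq n d -> depthseq n d' ->
  (forall x y, x < n -> y < n -> anc d x y = anc d' x y) ->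
  forall x, x < n -> d x = d' x.
Proof.
move=> dT dT' h; elim/ltn_ind => x IH xn.
have [->|x0] := eqVneq x 0; first by rewrite (proj1 dT) (proj1 dT').
have hx : 0 < x < n by lia.
have [p1 p2 p3] := parP dT hx; have [q1 q2 q3] := parP dT' hx.
have pn : par d x < n by lia. have qn : par d' x < n by lia.
have pq : anc d' (par d x) (par d' x).
  by apply: (anc_par dT' xn); [rewrite -h | rewrite neq_ltn p1].
have qp : anc d (par d' x) (par d x).
  by apply: (anc_par dT xn); [rewrite h | rewrite neq_ltn q1].
have e : par d x = par d' x by have := anc_leq dT' pq; have := anc_leq dT qp; lia.
by rewrite p2 q2 -e IH.
Qed.

(** * Both inclusions combined: the conditions on components and depths *)

Section Necessity.
Context {V : Type} (E : V -> V -> Prop) (n : nat).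
Context (d d' : nat -> nat) (dT : depthseq n d) (dT' : depthseq n d').
Hypothesis dd' : forall phi, tree_hom E n d phi -> tree_hom E n d' phi.
Hypothesis d'd : forall phi, tree_hom E n d' phi -> tree_hom E n d phi.
Hypothesis diff : exists2 x, x < n & d x <> d' x.

Lemma collapse : exists2 q, 0 < q &
  forall u v, backward E u -> forward E v -> wlk E q.+1 u v -> E u v.
Proof.
have [z [hz dz eqz]] := first_difference dT dT' diff.
case: (ltngtP (d z) (d' z)) dz => // lt _.
  exists (d' z - d z); first lia.
  by move=> u v; apply: (collapse_at dT' dT d'd hz _ lt) => y /eqz.
exists (d z - d' z); first lia.
by move=> u v; apply: (collapse_at dT dT' dd' hz eqz lt).
Qed.

Lemma collapse_rep : exists2 q, 0 < q &
  forall u v j, backward E u -> forward E v -> wlk E (1 + j * q) u v -> E u v.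
Proof.
have [q q0 hq] := collapse; exists q => // u v j; elim: j u => [|j IH] u bu fv.
  by move/wlk1.
have -> : 1 + j.+1 * q = q.+1 + j * q by rewrite mulSn addnA add1n.
move=> h; have [x [ux xv]] := wlk_split h; apply: IH => //.
exists x; split => //; apply: hq => //; apply: reach_forward fv.
by apply/reachP; exists (j * q).
Qed.

Lemma nec_whirl v : cyc E v -> exists p beta, whirl_index E (scc E v) p beta.
Proof.
move=> cv; have [q q0 hq] := collapse_rep; apply: (whirl_of_collapse q0 cv).
move=> x y j xv yv; apply: hq.
  by apply: cyc_backward; apply: (cyc_sc cv (sc_sym xv)).
by apply: cyc_forward; apply: (cyc_sc cv (sc_sym yv)).
Qed.

Lemma nec_isolated : scc_isolated E.
Proof.
move=> u v cu cv ruv; apply: contrapT => nvu.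
have [q q0 hq] := collapse_rep.
have [[|N] uv] := proj1 (reachP _ _ _) ruv.
  by apply: nvu; have -> : u = v by []; apply: reach_refl.
(* Prefixing [N * (q - 1)] steps inside the component of [u] makes the length [1 + N * q], which
   collapses to a single edge between the components. *)
have [x [xu sxu]] := cyc_back (N * q.-1) cu.
have cx : cyc E x by apply: (cyc_sc cu (sc_sym sxu)).
have xv : E x v.
  apply: (hq x v N); [exact: cyc_backward | exact: cyc_forward |].
  have := wlk_cat xu uv; suff -> : N * q.-1 + N.+1 = 1 + N * q by [].
  by rewrite -addn1 addnA addn1 -mulnSr prednK.
have nvx : ~ reach E v x by move=> vx; apply: nvu; apply: (reach_trans vx); case: sxu.
have [x0 x0n] := diff; apply.
apply: (anc_depths dT dT') => // y z yn zn; apply/idP/idP.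
  exact: (branch_sets dT' dT d'd cx cv xv nvx).
exact: (branch_sets dT dT' dd' cx cv xv nvx).
Qed.

Lemma nec_pleasant w k : pleasant E w k -> k < hgt n d 0.
Proof.
move=> [hw nc]; rewrite ltnNge; apply/negP => hk.
have h1 := pleasant_depth dT dT' dd' hw nc hk.
have hk' : hgt n d' 0 <= k.
  apply: leq_trans hk; apply: hgt_le => // y yn _; rewrite (proj1 dT').
  apply: leq_trans (h1 y yn) _.
  by have := hgt_ge yn (anc0 dT yn); rewrite (proj1 dT).
have h2 := pleasant_depth dT' dT d'd hw nc hk'.
by have [x xn] := diff; apply; apply/eqP; rewrite eqn_leq h1 ?h2.
Qed.

Lemma nec_outlet g l x : outlet E g l.+1 -> x < n -> hgt n d x <= l ->
  same_subtree n d d' x.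
Proof.
move=> og xn hl; have h1 := outlet_descend dT dT' dd' og xn hl.
apply: (sub_intro h1); apply: (outlet_descend dT' dT d'd og xn).
apply: leq_trans hl; apply: hgt_le => // y yn xy.
by have [a le] := h1 y yn xy; have := hgt_ge yn a; lia.
Qed.

Variable L : nat.
Hypothesis lev : forall x, x < n -> d x <= L \/ d' x <= L -> d x = d' x.
Hypothesis entry_bound : forall w l, entry E w l -> l <= L.+1.

Let lev' x : x < n -> d' x <= L \/ d x <= L -> d' x = d x.
Proof. by move=> xn h; rewrite lev //; case: h; [right | left]. Qed.

Lemma nec_omega r m x : 0 < r <= L.+1 -> in_omegaG E L.+1 r m -> x < n ->
  ~ same_subtree n d d' x -> d x <= r -> m < d x + hgt n d x.
Proof.
move=> hr [f [g [hf [cf [gf [hg [Lm ncg]]]]]]] xn ns dxr.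
rewrite ltnNge; apply/negP => hm; apply: ns.
(* This walk is still noncyclic at level [L + 1], the latest possible entry, so by [no_late_entry]
   nothing reachable from there is cyclic. *)
have hW : is_walk E (glue f r.-1 (fun i => g (r.-1 + i))) L.+1.
  have -> : L.+1 = r.-1 + (L.+1 - r.-1) by lia.
  move=> i; apply: glue_edge => [j jr||j jL]; first by apply: hf; lia.
    by rewrite addn0.
  by rewrite addnS; apply: hg; lia.
have WL : glue f r.-1 (fun i => g (r.-1 + i)) L.+1 = g L.+1.
  by rewrite glue_ge ?subnKC //; lia.
have esc y : reach E (g L.+1) y -> ~ cyc E y.
  move=> ry; apply: (no_late_entry nec_isolated entry_bound hW); by rewrite WL.
have nc i : L < i <= m -> ~ cyc E (g i).
  by move=> hi; apply: esc; apply: (segment_reach hg); lia.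
have [p [beta W]] := nec_whirl cf.
have [s [sN [Ks [_ [Es per]]]]] := whirl_line L.+1 W (sc_refl E (f L.+1)).
pose F := glue f L.+1 (fun i => s (i + L.+1)).
have hF : forall i, E (F i) (F i.+1).
  by apply: glue_edge_inf => // i; rewrite addSn.
have Fs i : L < i -> F i = s i by move=> Li; rewrite /F glue_ge // subnK.
have Ff i : i <= L.+1 -> F i = f i by move=> iL; rewrite /F glue_le.
have eg : g r.-1 = F r.-1 by rewrite gf Ff //; lia.
(* If [d x <= L], the descendants of [x] are the same in both trees and only depths are compared;
   otherwise [r = d x = L + 1] and the tail of [g] is hung at [x]. *)
have [dxL|dxL] := leqP (d x) L.
  have e : d x = d' x by apply: lev => //; left.
  have an y : y < n -> anc d x y = anc d' x y by move=> yn; rewrite (lev_anc lev).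
  have le1 := omega_shallow dT dT' dd' lev xn dxL dxr hr Lm hF eg hg nc hm.
  have hm' : d' x + hgt n d' x <= m.
    apply: leq_trans hm; rewrite -e leq_add2l; apply: hgt_le => // y yn xy.
    by apply: leq_trans (le1 y yn xy) _; rewrite -e; apply: hgt_ge; rewrite ?an.
  have le2 : forall y, y < n -> anc d x y -> d y <= d' y.
    by apply: (omega_shallow dT' dT d'd lev' (r := r) (F := F) (g := g) (m := m)) => //;
       rewrite -?e.
  move=> y yn; split; first exact: an.
  by move=> xy; have := le1 y yn; rewrite -an // => /(_ xy); have := le2 y yn xy; lia.
have rL : r = L.+1 by lia. have dx : d x = L.+1 by lia.
have d'x : L < d' x by rewrite -(lev_gt lev xn).
have e0 : E (F L) (g L.+1).
  by move: eg; rewrite rL /= => <-; apply: hg; rewrite rL /=; lia.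
pose ga i := g (L.+1 + i).
have hga : is_walk E ga (m - L.+1).
  by move=> i im; rewrite /ga addnS; apply: hg; lia.
have ncga i : i <= m - L.+1 -> ~ cyc E (ga i) by move=> im; apply: nc; lia.
have nE i y : i <= m - L.+1 -> L < y -> ~ E (ga i) (F y).
  move=> im Ly eg2; apply: (esc (F y)).
    by apply: (reach_trans _ (reach_edge eg2)); apply: (segment_reach hg); lia.
  by rewrite Fs //; apply: (cyc_sc cf (sc_sym (Ks y))).
have hx : 0 < x < n.
  by rewrite xn andbT lt0n; apply/eqP => ex; move: dx; rewrite ex (proj1 dT).
have h1 : forall y, y < n -> anc d' x y -> anc d x y /\ d' y + d x <= d y + d' x.
  apply: (branch_descend dT dT' dd' xn hF _ hga ncga); first lia.
    by move=> _; rewrite dx /ga addn0.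
  move=> i y im yn xy _; apply: nE => //.
  by rewrite (lev_gt lev yn); have := anc_depth dT' xy; lia.
apply: (sub_intro h1).
apply: (branch_descend dT' dT d'd xn hF _ hga ncga).
- have hm' : hgt n d x <= m - L.+1 by lia.
  apply: leq_trans hm'; apply: hgt_le => // y yn xy.
  by have [a le] := h1 y yn xy; have := hgt_ge yn a; lia.
(* In the second tree [x] may be deeper than [L + 1]. A homomorphism of the first tree, read in the
   second, gives an edge from level [d (par d' x)] to the tail of [g]; periodicity moves it to the
   congruent level [d' x - 1]. *)
- move=> _; rewrite /ga addn0.
  have [->|d'xL] := eqVneq (d' x) L.+1; first by [].
  have [_ d'x2 pn term_depth] := deep_parent dT dT' lev xn dx (elimN eqP d'xL).
  have p2 := par_depth dT' hx.
  have hm1 : tree_hom E n d (branch d x (fun y => F (d y)) (fun i => ga (i - d x))).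
    apply: branch_level_hom => //; first by rewrite dx subnn /ga addn0.
    by move=> i hi; rewrite subSn; [apply: hga; lia | lia].
  have := branch_cut dT dT' hx (dd' hm1); rewrite subnn /ga addn0.
  have -> // : F (d (par d' x)) = F (d' x).-1.
  rewrite !Fs; [|lia|lia]; apply: per; rewrite p2 /=.
  exact: (whirl_depth dT dT' dd' W).
- move=> i y im yn xy _; apply: nE => //.
  by rewrite -(lev_gt lev yn); have := anc_depth dT xy; lia.
Qed.

End Necessity.

(** * Sufficiency *)

Section TreeWalk.
Context {V : Type} (E : V -> V -> Prop) (n : nat) (d : nat -> nat).
Context (dT : depthseq n d) (phi : nat -> V) (hphi : tree_hom E n d phi).

Lemma tree_walk y : y < n -> is_walk E (fun i => phi (up d y i)) (d y).
Proof.
move=> yn i iy; rewrite -(par_up dT yn iy); apply: hphi.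
by apply: (up_gt0 dT); lia.
Qed.

Lemma anc_reach y z : z < n -> anc d y z -> reach E (phi y) (phi z).
Proof.
move=> zn yz; have := walk_reach (tree_walk zn) (i := d y) (j := d z).
by rewrite (anc_up yz) (up_id dT) leqnn andbT; apply; apply: (anc_depth dT).
Qed.

Lemma tree_entry y : y < n -> cyc E (phi y) ->
  exists2 k, k <= d y & entry E (fun i => phi (up d y i)) k.
Proof.
move=> yn cy; apply: (first_entry (tree_walk yn)).
by rewrite (up_id dT).
Qed.

(** [t] is the nearest ancestor of [z], or [z] itself, with a cyclic parent. By isolation nothing
    below [t] is cyclic, so that parent and a longest branch below [t] form an outlet. *)
Lemma outlet_top : scc_isolated E ->
  forall z a, z < n -> anc d a z -> cyc E (phi a) -> ~ cyc E (phi z) ->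
  exists t, [/\ 0 < t < n, anc d t z, ~ cyc E (phi t), cyc E (phi (par d t))
    & exists g, outlet E g (hgt n d t).+1].
Proof.
move=> iso z a + az ca; elim/ltn_ind: z az => z IH az zn ncz.
have anz : a != z by apply/eqP => e; apply: ncz; rewrite -e.
have hz : 0 < z < n by have := anc_leq dT az; lia.
have [p1 p2 p3] := parP dT hz; have pn : par d z < n by lia.
have [cp|ncp] := EM (cyc E (phi (par d z))); last first.
  have [t [h1 h2 h3 h4 h5]] := IH _ p1 (anc_par dT zn az anz) pn ncp.
  by exists t; split => //; apply: (anc_trans dT h2 p3).
exists z; split => //; first exact: (anc_refl dT).
have [s [sn zs ds]] := hgt_attained dT zn.
exists (fun i => phi (up d s (d (par d z) + i))).
have us : up d s (d z) = z by apply: anc_up.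
have ups : up d s (d (par d z)) = par d z by apply: anc_up; apply: (anc_trans dT p3 zs).
have hw : is_walk E (fun i => phi (up d s (d (par d z) + i))) (hgt n d z).+1.
  by move=> i hi; rewrite addnS; apply: (tree_walk sn); lia.
split => //; split; first by rewrite addn0 ups.
move=> i hi ci; apply: ncz.
have e0 : phi (up d s (d (par d z) + 0)) = phi (par d z) by rewrite addn0 ups.
have e1 : phi (up d s (d (par d z) + 1)) = phi z by rewrite addn1 -p2 us.
have r1 : reach E (phi (par d z)) (phi z) by apply: anc_reach.
have r2 : reach E (phi z) (phi (up d s (d (par d z) + i))).
  by rewrite -{1}e1; apply: (walk_reach hw (i := 1) (j := i)); lia.
by apply: (between_cyc cp r1 r2); apply: (iso _ _ cp ci); apply: (reach_trans r1 r2).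
Qed.

Lemma block_depth v p beta c y : scc_isolated E -> cyc E v ->
  whirl_index E (scc E v) p beta ->
  sc E (phi c) v -> y < n -> anc d c y -> cyc E (phi y) ->
  sc E (phi y) v /\ beta (phi y) + d c = beta (phi c) + d y %[mod p].
Proof.
move=> iso cv W scv; have cc : cyc E (phi c) by apply: (cyc_sc cv (sc_sym scv)).
have inK z : z < n -> anc d c z -> cyc E (phi z) -> sc E (phi z) v.
  move=> zn cz cyz; have r := anc_reach zn cz.
  by apply: (sc_trans (conj (iso _ _ cc cyz r) r) scv).
move: y; apply: (anc_ind dT); first by split.
move=> y yn cy cly cp IH cyy; split; first exact: inK.
have hy : 0 < y < n by lia.
have [p1 p2 p3] := parP dT hy; have pn : par d y < n by lia.
have cpc : cyc E (phi (par d y)).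
  apply: (between_cyc cc (anc_reach pn cp) (anc_reach yn p3)).
  by apply: (iso _ _ cc cyy (anc_reach yn cy)).
have [s1 e1] := IH cpc.
have := whirl_edgeE W s1 (inK y yn cy cyy) (hphi hy) => e2.
by apply: (eqmod_add2 (esym e1) (esym e2)); rewrite p2; clear; lia.
Qed.

End TreeWalk.

Section Sufficiency.
Context {V : Type} (E : V -> V -> Prop) (n : nat).
Context (d d' : nat -> nat) (dT : depthseq n d) (dT' : depthseq n d').
Variable L : nat.
Hypothesis lev : forall x, x < n -> d x <= L \/ d' x <= L -> d x = d' x.
Hypothesis whirls : forall v, cyc E v -> exists p beta, whirl_index E (scc E v) p beta.
Hypothesis iso : scc_isolated E.
Hypothesis cong : forall v p beta, whirl_index E (scc E v) p beta ->
  forall x, x < n -> d x = d' x %[mod p].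
Hypothesis pleasant_bound : forall w k, pleasant E w k -> k < hgt n d 0.
Hypothesis entry_bound : forall w l, entry E w l -> l <= L.+1.
Hypothesis outlet_sub : forall g l x, outlet E g l.+1 -> x < n -> hgt n d x <= l ->
  same_subtree n d d' x.
Hypothesis Z_bound : forall m x, in_ZG E m -> 0 < x < n -> same_subtree n d d' x ->
  par d x <> par d' x -> m < hgt n d x.
Hypothesis B_bound : forall m, in_BG E m -> m < L.
Hypothesis O_bound : forall r m x, 0 < r <= L.+1 -> in_omegaG E L.+1 r m -> x < n ->
  ~ same_subtree n d d' x -> d x <= r -> m < d x + hgt n d x.
Hypothesis L_bound : forall m x, in_lambdaG E L.+1 m -> x < n -> d x <> d' x ->
  d x = L.+1 \/ d' x = L.+1 -> m < maxn (hgt n d x) (hgt n d' x).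
Hypothesis L_witness : exists2 x, x < n & d x <> d' x /\ (d x = L.+1 \/ d' x = L.+1).

Section Vertex.
Variable phi : nat -> V.
Hypothesis hphi : tree_hom E n d phi.

Lemma some_cyc : exists2 y, y < n & cyc E (phi y).
Proof.
have n0 : 0 < n by have [x xn _] := L_witness; lia.
apply: contrapT => nc; have [s [sn _ ds]] := hgt_attained dT n0.
have : pleasant E (fun i => phi (up d s i)) (d s).
  split; first exact: (tree_walk dT).
  move=> i si ci; apply: nc; exists (up d s i) => //.
  by have [_ a] := upP dT sn si; have := anc_leq dT a; lia.
by move/pleasant_bound; rewrite ds (proj1 dT); lia.
Qed.

Lemma outlet_top_sub z a : z < n -> anc d a z -> cyc E (phi a) -> ~ cyc E (phi z) ->
  exists t, [/\ 0 < t < n, anc d t z, ~ cyc E (phi t), cyc E (phi (par d t))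
    & same_subtree n d d' t].
Proof.
move=> zn az ca ncz.
have [t [h1 h2 h3 h4 [g hg]]] := outlet_top dT hphi iso zn az ca ncz.
by exists t; split => //; apply: (outlet_sub hg) => //; case/andP: h1.
Qed.

(** Otherwise the branch to [y], prolonged inside the component it enters, and a longest branch
    through [b] witness [in_omegaG] with [r = d b] and [m = d b + hgt n d b], against [O_bound]. *)
Lemma pleasant_subtree b y : b < n -> 0 < d b <= L.+1 ->
  (forall z, z < n -> anc d b z -> ~ cyc E (phi z)) ->
  (forall i, i < d b -> ~ cyc E (phi (up d b i))) ->
  y < n -> anc d (par d b) y -> cyc E (phi y) -> L < d b + hgt n d b ->
  same_subtree n d d' b.
Proof.
move=> bn db ncb nca yn py cy Lh; apply: contrapT => ns.
have b0 : 0 < b < n.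
  by rewrite bn andbT lt0n; apply/eqP => e; move: db; rewrite e (proj1 dT).
have [p1 p2 p3] := parP dT b0.
have [k ky [h1 [h2 h3]]] := tree_entry dT hphi yn cy.
have kL : k <= L.+1 by apply: (entry_bound (conj h1 (conj h2 h3))).
have upb i : i < d b -> up d y i = up d b i.
  by move=> ib; rewrite (up_up dT yn py) ?(up_up dT bn p3) //; lia.
have kb : d b <= k.
  by rewrite leqNgt; apply/negP => kb; apply: (nca k kb); rewrite -upb.
have [s [s0 hs]] := cyc_walk h3.
have e : (fun i => phi (up d y i)) k = s 0 by rewrite s0.
have [z [zn bz dz]] := hgt_attained dT bn.
suff /O_bound : in_omegaG E L.+1 (d b) (d b + hgt n d b).
  by move/(_ b db bn ns (leqnn _)); rewrite ltnn.
exists (glue (fun i => phi (up d y i)) k s), (fun i => phi (up d z i)).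
split.
  by move=> i _; apply: (glue_edge_inf h1 e) => j; case: (hs j).
split; first by rewrite glue_ge //; apply: (cyc_sc h3); case: (hs (L.+1 - k)).
split.
  rewrite glue_le //; last by lia.
  by rewrite upb ?(up_up dT zn bz) //; lia.
split; first by move=> i hi; apply: (tree_walk dT hphi zn); lia.
split => //; apply: ncb; last by apply: (up_anc dT zn bz); lia.
have Lz : L.+1 <= d z by lia.
by have [_ az] := upP dT zn Lz; have := anc_leq dT az; lia.
Qed.

Variable x : nat.
Hypothesis hx : 0 < x < n.
Hypothesis np : par d x <> par d' x.
Local Notation q := (par d' x).
Local Notation a := (up d x L).

Let xn : x < n. Proof. by case/andP: hx. Qed.
Let qx : q < x. Proof. exact: (par_lt dT'). Qed.
Let qn : q < n. Proof. exact: ltn_trans qx xn. Qed.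
Let pn : par d x < n. Proof. exact: ltn_trans (par_lt dT hx) xn. Qed.

Let sub_top t : same_subtree n d d' t -> anc d t x -> t = x.
Proof.
move=> st tx; apply/eqP/negPn/negP => ne.
by apply: np; apply: (sub_par dT dT' st xn tx ne).
Qed.

(** If [q] lay below [t], so would [x]; then [t = x] by [sub_top], although [q] precedes [x]. *)
Let sub_parent t : same_subtree n d d' t -> ~ anc d t q.
Proof.
move=> st tq; have tq' : anc d' t q by have [<-] := st q qn.
have tx' := anc_trans dT' tq' (par_anc dT' hx).
have tx : anc d t x by have [->] := st x xn.
by have := sub_top st tx; have := anc_leq dT tq; lia.
Qed.

Let dx_gt : L < d x.
Proof.
rewrite ltnNge; apply/negP => h; apply: np; apply: (lev_par lev xn); last by lia.
by apply: lev => //; left.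
Qed.

Let da : d a = L. Proof. by have [] := upP dT xn (ltnW dx_gt). Qed.
Let upL : up d a L = a. Proof. by have := up_id dT a; rewrite da. Qed.
Let ax : anc d a x. Proof. by have [] := upP dT xn (ltnW dx_gt). Qed.
Let anx : a != x. Proof. by apply/eqP => e; move: da dx_gt; rewrite e; lia. Qed.
Let an : a < n. Proof. by have := anc_leq dT ax; have := xn; lia. Qed.

Let aq : anc d a q.
Proof.
rewrite (lev_anc lev) ?da //; apply: (anc_par dT' xn _ anx).
by rewrite -(lev_anc lev) ?da.
Qed.

Let q_depth p v beta : whirl_index E (scc E v) p beta -> (d q).+1 = d x %[mod p].
Proof.
move=> W; apply: (eqmod_add2 (esym (cong W qn)) (cong W xn)).
by rewrite (par_depth dT' hx); clear; lia.
Qed.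

(** If the edge failed, a longest branch below [x], preceded by its parent, would show that [Z_G] is
    at least the height of [T_x]. *)
Lemma edge_of_Z v p beta : whirl_index E (scc E v) p beta -> ~ cyc E (phi x) ->
  same_subtree n d d' x -> sc E (phi (par d x)) v -> sc E (phi q) v ->
  beta (phi (par d x)) = beta (phi q) %[mod p] -> E (phi q) (phi x).
Proof.
move=> W ncx sx sp sq bpq; apply: contrapT => nE.
have [s [sn xs ds]] := hgt_attained dT xn.
have [p1 p2 p3] := parP dT hx.
suff /Z_bound : in_ZG E (hgt n d x) by move/(_ x hx sx np); rewrite ltnn.
exists (scc E v), p, beta, (phi (par d x)), (phi q).
exists (fun i => phi (up d s (d (par d x) + i))).
split; first by exists v.
do 4!split => //; split.
  by move=> i hi; rewrite addnS; apply: (tree_walk dT hphi sn); lia.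
split; first by rewrite addn0 (anc_up (anc_trans dT p3 xs)).
by rewrite addn1 -p2 (anc_up xs).
Qed.

Lemma edge_below_cyc : cyc E (phi a) -> E (phi q) (phi x).
Proof.
move=> ca; have [p [beta W]] := whirls ca.
have cq : cyc E (phi q).
  apply: contrapT => ncq; have [t [_ tq _ _ st]] := outlet_top_sub qn aq ca ncq.
  exact: sub_parent st tq.
have [sq bq] := block_depth dT hphi iso ca W (sc_refl E _) qn aq cq.
have dq := q_depth W.
have [cx|ncx] := EM (cyc E (phi x)).
  have [sx bx] := block_depth dT hphi iso ca W (sc_refl E _) xn ax cx.
  apply: (whirl_edge W sq sx); apply: (eqmod_add3 (esym bx) bq dq).
  by clear; lia.
have [t [_ tx _ cp st]] := outlet_top_sub xn ax ca ncx.
have tex := sub_top st tx; subst t.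
have ap := anc_par dT xn ax anx.
have [sp bp] := block_depth dT hphi iso ca W (sc_refl E _) pn ap cp.
apply: (edge_of_Z W ncx st sp sq); apply: (eqmod_add3 (esym bp) bq dq).
by rewrite (par_depth dT hx); clear; lia.
Qed.

Hypothesis nca : ~ cyc E (phi a).

(** A cyclic vertex on the branch to [a] would start an outlet whose top has equal subtrees and must
    be [x], although [a] is a proper ancestor of [x]. *)
Let pre i : i <= L -> ~ cyc E (phi (up d a i)).
Proof.
move=> iL ci; have iL' : i <= d a by rewrite da.
have [_ ua] := upP dT an iL'.
have [t [_ ta _ _ st]] := outlet_top_sub an ua ci nca.
have := sub_top st (anc_trans dT ta ax); have := anc_leq dT ta.
by have := anc_leq dT ax; have := anx; lia.
Qed.

Let up_a y i : y < n -> anc d a y -> i <= L -> up d y i = up d a i.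
Proof. by move=> yn ay iL; apply: (up_up dT yn ay); rewrite da. Qed.

Lemma cyc_below : exists y, [/\ y < n, anc d a y & cyc E (phi y)].
Proof.
apply: contrapT => nc.
(* With [k] least, the ancestor [b] of [a] at depth [k] satisfies the assumptions of
   [pleasant_subtree], although it is a proper ancestor of [x]. *)
pose P k := `[< forall y, y < n -> anc d (up d a k) y -> ~ cyc E (phi y) >].
have exP : exists k, P k.
  exists L; apply/asboolP => y yn; rewrite upL => ay cy.
  by apply: nc; exists y.
case: (ex_minnP exP) => k /asboolP hk min.
have kL : k <= L.
  apply: min; apply/asboolP => y yn; rewrite upL => ay cy.
  by apply: nc; exists y.
have k0 : 0 < k.
  rewrite lt0n; apply/eqP => e; have [y yn cy] := some_cyc.
  apply: (hk y yn) cy; rewrite e -(proj1 dT) (anc_up (anc0 dT an)).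
  exact: (anc0 dT).
have kL' : k <= d a by rewrite da.
have [db ba] := upP dT an kL'; set b := up d a k in hk db ba.
have bn : b < n by have := anc_leq dT ba; lia.
have pb : par d b = up d a k.-1.
  by rewrite -(par_up dT an) ?prednK // da; lia.
have [y [yn py cy]] : exists y, [/\ y < n, anc d (par d b) y & cyc E (phi y)].
  apply: contrapT => ny; have : k <= k.-1; last by lia.
  by apply: min; apply/asboolP => y yn; rewrite -pb => py cy; apply: ny; exists y.
have bx := anc_trans dT ba ax.
have sb : same_subtree n d d' b.
  apply: (pleasant_subtree bn _ hk _ yn py cy).
  - by rewrite db k0; lia.
  - move=> i; rewrite db => ik; rewrite -(up_up dT an ba) ?db 1?ltnW //.
    by apply: pre; lia.
  - by have := hgt_ge xn bx; lia.
have := sub_top sb bx; have := anc_leq dT ba; have := anc_leq dT ax.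
by have := anx; lia.
Qed.

(** The branch to [y] enters a component at level at most [L + 1] by [entry_bound] and beyond [L] by
    [pre], hence exactly at [L + 1]. *)
Let deep_cyc y : y < n -> anc d a y -> cyc E (phi y) ->
  L < d y /\ cyc E (phi (up d y L.+1)).
Proof.
move=> yn ay cy; have [k ky en] := tree_entry dT hphi yn cy.
have kL := entry_bound en; have ck : cyc E (phi (up d y k)) by case: en => _ [].
have [k1|k1] := leqP k L; first by case: (pre k1); rewrite -(up_a yn ay).
by have -> : L.+1 = k by lia.
Qed.

Definition child c := [/\ c < n, anc d a c & d c = L.+1].

Let childP y : y < n -> anc d a y -> L < d y ->
  child (up d y L.+1) /\ anc d (up d y L.+1) y.
Proof.
move=> yn ay Ly; have [e uy] := upP dT yn Ly; split => //; split => //.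
  by have := anc_leq dT uy; lia.
by apply: (up_anc dT yn ay); rewrite da leqnSn.
Qed.

Let child_par c : child c -> par d c = a.
Proof. by move=> [cn ac dc]; apply: (par_eq dT cn ac); rewrite da. Qed.

Let pleasant_child c : child c -> ~ cyc E (phi c) -> same_subtree n d d' c.
Proof.
move=> hc ncc; have [cn ac dc] := hc; have [y [yn ay cy]] := cyc_below.
apply: (pleasant_subtree (y := y) cn) => //; try by rewrite ?(child_par hc); lia.
  move=> z zn cz cyz; have [_ h] := deep_cyc zn (anc_trans dT ac cz) cyz.
  by apply: ncc; move: h; rewrite -dc (anc_up cz).
by move=> i ic; rewrite (up_a cn ac); [apply: pre|]; lia.
Qed.

Let child_entry c : child c -> cyc E (phi c) -> entry E (fun i => phi (up d c i)) L.+1.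
Proof.
move=> [cn ac dc] cc; split; first by rewrite -dc; apply: (tree_walk dT hphi).
split; last by rewrite -dc (up_id dT).
by move=> i iL; rewrite (up_a cn ac) //; apply: pre.
Qed.

Let upcL c : child c -> up d c L = a.
Proof. by move=> [cn ac dc]; rewrite (up_a cn ac) // upL. Qed.

Let upcS c : child c -> up d c L.+1 = c.
Proof. by move=> [cn ac dc]; rewrite -dc (up_id dT). Qed.

Let in_lambdaG_child c w v m : child c -> cyc E (phi c) -> sc E w (phi c) -> E w (phi c) ->
  is_walk E v m -> ~ (E w (v 0) <-> E (phi a) (v 0)) -> in_lambdaG E L.+1 m.
Proof.
move=> hc cc sw wc hv ne; exists (fun i => phi (up d c i)), w, v.
rewrite /= (upcS hc) (upcL hc); split; first exact: child_entry.
do 3!split => //; split => [e1 e2|h]; first by apply: ne; split.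
apply: contrapT => nw; apply: nw; apply: contrapT => nw; apply: ne.
by split => // e; case: (nw); apply: contrapT => nw'; apply: nw; apply: h => e'; apply: nw'.
Qed.

(** A cyclic [z] starts walks of every length, so if exactly one of the two edges existed,
    [lambda_G] would reach the bound given by the witness [x1]. *)
Lemma same_out c w z : child c -> cyc E (phi c) -> sc E w (phi c) -> E w (phi c) ->
  cyc E z -> (E w z <-> E (phi a) z).
Proof.
move=> hc cc sw wc cz; apply: contrapT => ne.
have [x1 x1n [dx1 lx1]] := L_witness; have [s [s0 hs]] := cyc_walk cz.
have hw : is_walk E s (maxn (hgt n d x1) (hgt n d' x1)) by move=> i _; case: (hs i).
rewrite -s0 in ne; have := L_bound (in_lambdaG_child hc cc sw wc hw ne) x1n dx1 lx1.
by rewrite ltnn.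
Qed.

Lemma edge_below_pleasant : E (phi q) (phi x).
Proof.
have [y0 [y0n ay0 cy0]] := cyc_below.
have [Ly0 cc0] := deep_cyc y0n ay0 cy0.
have [hc0 _] := childP y0n ay0 Ly0; set c0 := up d y0 L.+1 in hc0 cc0.
have [p [beta W]] := whirls cc0.
have edge_a c : child c -> E (phi a) (phi c).
  move=> hc; rewrite -(child_par hc); apply: hphi; have [cn _ dc] := hc.
  by rewrite cn andbT lt0n; apply/eqP => e; move: dc; rewrite e (proj1 dT).
(* Otherwise the walk of length [L] to [phi a] would fork into two components. *)
have csc c : child c -> cyc E (phi c) -> sc E (phi c) (phi c0).
  move=> hc cc; apply: contrapT => ns; suff /B_bound : in_BG E L by rewrite ltnn.
  exists (fun i => phi (up d a i)), (phi c), (phi c0).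
  rewrite upL; split; first by have := tree_walk dT hphi an; rewrite da.
  by split; [exact: edge_a | split; [exact: edge_a | split]].
have [w [wc0 sw]] := cyc_prev cc0.
have bw := whirl_edgeE W (sc_sym sw) (sc_refl E _) wc0.
(* By [same_out] the cyclic children of [a] go to out-neighbours of [w], that is, to the block
   following that of [w]. *)
have cbl c : child c -> cyc E (phi c) -> beta (phi c) = beta (phi c0) %[mod p].
  move=> hc cc; have := proj2 (same_out hc0 cc0 (sc_sym sw) wc0 cc) (edge_a _ hc).
  by move/(whirl_edgeE W (sc_sym sw) (csc _ hc cc)) => ->.
have blk y : y < n -> anc d a y -> cyc E (phi y) ->
    sc E (phi y) (phi c0) /\ beta (phi y) + L.+1 = beta (phi c0) + d y %[mod p].
  move=> yn ay cy; have [Ly cc] := deep_cyc yn ay cy.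
  have [hc cy'] := childP yn ay Ly.
  have [s1 b1] := block_depth dT hphi iso cc0 W (csc _ hc cc) yn cy' cy.
  split => //; have [_ _ dc] := hc; rewrite dc in b1.
  by apply: (eqmod_add2 (esym b1) (esym (cbl _ hc cc))); clear; lia.
have dq := q_depth W.
have qP : q = a \/ cyc E (phi q).
  have [->|qna] := eqVneq q a; [by left | right].
  have Lq : L < d q by have := anc_depth_lt dT aq; rewrite da eq_sym; apply.
  have [hc cq] := childP qn aq Lq.
  have cc : cyc E (phi (up d q L.+1)).
    by apply: contrapT => nc; apply: (sub_parent (pleasant_child hc nc)).
  apply: contrapT => ncq; have [t [_ tq _ _ st]] := outlet_top_sub qn cq cc ncq.
  exact: sub_parent st tq.
have [hcx cx] := childP xn ax dx_gt; set c := up d x L.+1 in hcx cx.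
have dxx : q = a -> d' x = L.+1.
  by move=> e; rewrite (par_depth dT' hx) e -lev ?da //; left.
have dne : d x = L.+1 \/ d' x = L.+1 -> d x <> d' x.
  move=> h e; apply: np; apply: (lev_par lev xn e).
  by case: h => [->//|h]; rewrite e h.
have Lh m : same_subtree n d d' x -> d x = L.+1 \/ d' x = L.+1 -> in_lambdaG E L.+1 m ->
    m < hgt n d x.
  by move=> sx h hm; have := L_bound hm xn (dne h) h; rewrite -(sub_hgt sx) maxnn.
have [s [sn xs ds]] := hgt_attained dT xn.
have hv : is_walk E (fun i => phi (up d s (d x + i))) (hgt n d x).
  by move=> i hi; rewrite addnS; apply: (tree_walk dT hphi sn); rewrite ds ltn_add2l.
have v0 : phi (up d s (d x + 0)) = phi x by rewrite addn0 (anc_up xs).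
(* A noncyclic [c] has equal subtrees, so [c = x]. The edge from [phi a] to [phi x] exists; if the
   one from [phi q] failed, a longest branch below [x] would contradict [L_bound] with
   [w = phi q]. *)
have [cc|ncc] := EM (cyc E (phi c)); last first.
  have sc' := pleasant_child hcx ncc.
  have ecx := sub_top sc' cx; rewrite ecx in hcx ncc sc'.
  have [_ _ dx] := hcx.
  have ex : E (phi a) (phi x) by apply: edge_a.
  case: qP => [e|cq]; first by case: np; rewrite e (child_par hcx).
  have [Lq ccq] := deep_cyc qn aq cq; have [hcq cqq] := childP qn aq Lq.
  have [sq bq] := blk q qn aq cq.
  have sqc := sc_trans sq (sc_sym (csc _ hcq ccq)).
  have eqc : E (phi q) (phi (up d q L.+1)).
    apply: (whirl_edge W sq (csc _ hcq ccq)).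
    apply: (eqmod_add3 (esym (cbl _ hcq ccq)) bq dq).
    by rewrite dx; clear; lia.
  apply: contrapT => nE.
  have := Lh _ sc' (or_introl dx) (in_lambdaG_child hcq ccq sqc eqc hv _).
  by rewrite v0 ltnn => /(_ (fun h => nE (proj2 h ex))).
have [cyx|ncx] := EM (cyc E (phi x)).
  have [sx bx] := blk x xn ax cyx.
  case: qP => [e|cq]; last first.
    have [sq bq] := blk q qn aq cq.
    by apply: (whirl_edge W sq sx); apply: (eqmod_add3 (esym bx) bq dq); clear; lia.
  rewrite e; apply/(same_out hc0 cc0 (sc_sym sw) wc0 cyx).
  apply: (whirl_edge W (sc_sym sw) sx).
  apply: (eqmod_add3 (esym bx) (esym (cong W xn)) (esym bw)).
  by rewrite (dxx e); clear; lia.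
have [t [_ tx _ cp st]] := outlet_top_sub xn cx cc ncx.
have tex := sub_top st tx; subst t.
have ap := anc_par dT xn ax anx.
have [sp bp] := blk (par d x) pn ap cp.
case: qP => [e|cq]; last first.
  have [sq bq] := blk q qn aq cq.
  apply: (edge_of_Z W ncx st sp sq); apply: (eqmod_add3 (esym bp) bq dq).
  by rewrite (par_depth dT hx); clear; lia.
(* Now [q = a] and [d' x = L + 1]. The image of [par d x] lies in the block before that of [phi c]
   and serves as [w], with a longest branch below [x] as the walk. *)
have ep : E (phi (par d x)) (phi x) by apply: hphi.
have spc := sc_trans sp (sc_sym (csc _ hcx cc)).
have epc : E (phi (par d x)) (phi c).
  apply: (whirl_edge W sp (csc _ hcx cc)).
  apply: (eqmod_add3 (esym (cbl _ hcx cc)) bp (cong W xn)).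
  by rewrite (dxx e) (par_depth dT hx); clear; lia.
apply: contrapT => nE; rewrite e in nE.
have := Lh _ st (or_intror (dxx e)) (in_lambdaG_child hcx cc spc epc hv _).
by rewrite v0 ltnn => /(_ (fun h => nE (proj1 h ep))).
Qed.

End Vertex.

Theorem sufficiency phi : tree_hom E n d phi -> tree_hom E n d' phi.
Proof.
move=> hphi x hx; have [<-|/eqP np] := eqVneq (par d x) (par d' x); first exact: hphi.
have [ca|nca] := EM (cyc E (phi (up d x L))).
  exact: edge_below_cyc.
exact: edge_below_pleasant.
Qed.

End Sufficiency.

(** * The trees of bracketings *)

Fixpoint term_depth (t : bterm) (x : nat) : nat :=
  match t with
  | BLeaf => 0
  | BNode a b => if x < nleaves a then term_depth a x else (term_depth b (x - nleaves a)).+1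
  end.

Lemma nleaves_gt0 t : 0 < nleaves t.
Proof. by elim: t => //= a IHa b IHb; lia. Qed.

Lemma term_depth0 t : term_depth t 0 = 0.
Proof. by elim: t => //= a IHa b IHb; rewrite nleaves_gt0. Qed.

Lemma term_depthseq t : depthseq (nleaves t) (term_depth t).
Proof.
split; first exact: term_depth0.
elim: t => //= a IHa b IHb i ilt.
have [ia|ai] := ltnP i.+1 (nleaves a); first by rewrite (ltnW ia); apply: IHa.
have [ia'|ai'] := ltnP i (nleaves a).
  have -> : i.+1 - nleaves a = 0 by lia.
  by rewrite term_depth0.
by rewrite subSn //; have := IHb (i - nleaves a); lia.
Qed.

(** The right factor begins at the last vertex of depth one, so the depth sequence determines where
    the term splits. *)
Lemma term_depth_inj t t' : nleaves t = nleaves t' ->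
  (forall x, x < nleaves t -> term_depth t x = term_depth t' x) -> t = t'.
Proof.
elim: t t' => [|a IHa b IHb] [|a' b'] //=.
- by have := nleaves_gt0 a'; have := nleaves_gt0 b'; lia.
- by have := nleaves_gt0 a; have := nleaves_gt0 b; lia.
move=> en h; have a0 := nleaves_gt0 a; have b0 := nleaves_gt0 b.
have a0' := nleaves_gt0 a'; have b0' := nleaves_gt0 b'.
have ea : nleaves a = nleaves a'.
  case: (ltngtP (nleaves a) (nleaves a')) => // lt; exfalso.
    have := h (nleaves a'); rewrite ltnn subnn term_depth0 ifN; last by lia.
    have := depth_gt0 (term_depthseq b) (x := nleaves a' - nleaves a); lia.
  have := h (nleaves a); rewrite ltnn subnn term_depth0 ifN; last by lia.
  have := depth_gt0 (term_depthseq b') (x := nleaves a - nleaves a'); lia.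
congr BNode.
  by apply: IHa => // x xa; have := h x; rewrite -ea xa; apply; lia.
apply: IHb => [|x xb]; first lia.
have := h (nleaves a + x); rewrite -ea !ltnNge !leq_addr /= addKn => /(_ ltac:(lia)).
by case.
Qed.

(** The edge from parent to child described by an interval of depths, a form that restricts and
    shifts to the factors of a term. *)
Definition preorder_edge n (d : nat -> nat) u v :=
  [/\ u < v < n, d v = (d u).+1 & forall z, u < z < v -> d v <= d z].

Lemma gedges_preorder t u v :
  (u, v) \in gedges t <-> preorder_edge (nleaves t) (term_depth t) u v.
Proof.
elim: t u v => [|a IHa b IHb] u v /=.
  by split => // -[h]; lia.
rewrite !mem_cat inE; have a0 := nleaves_gt0 a; have b0 := nleaves_gt0 b.
split.
  case/or3P => [/IHa[h1 h2 h3]|/mapP[[u' v'] /= /IHb[h1 h2 h3] [-> ->]]|/eqP[-> ->]].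
  - have va : v < nleaves a by lia.
    have ua : u < nleaves a by lia.
    split; rewrite ?va ?ua //; first lia.
    by move=> z hz; rewrite ifT; [apply: h3 | lia].
  - split; first lia.
      by rewrite !ltnNge !leq_addl /= !addnK h2.
    move=> z hz; rewrite !ltnNge leq_addl /= addnK ifN -?leqNgt; last by lia.
    by rewrite ltnS; apply: h3; lia.
  - split; first lia.
      by rewrite ltnn subnn a0 !term_depth0.
    move=> z hz; rewrite ltnn subnn term_depth0 ifT; last by lia.
    by apply: (depth_gt0 (term_depthseq a)); lia.
move=> [h1 + h3]; have [va|av] := ltnP v (nleaves a).
  rewrite ifT; last by lia.
  move=> h2; apply/orP; left; apply/IHa; split => //; first lia.
  move=> z hz; have := h3 z hz; rewrite va ifT //; lia.
have [ua|au] := ltnP u (nleaves a) => h2.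
  (* Unless [v] is the root of the right factor, that root, of depth one, lies strictly between [u]
     and [v]; so only the edge between the two roots crosses. *)
  have dv : term_depth b (v - nleaves a) = 0.
    case: (eqVneq v (nleaves a)) => [->|ne]; first by rewrite subnn term_depth0.
    have := h3 (nleaves a); rewrite ltnn subnn term_depth0 (ltnNge v) av /=; lia.
  have ev : v = nleaves a.
    apply/eqP/negPn/negP => ne.
    by have := depth_gt0 (term_depthseq b) (x := v - nleaves a); rewrite dv; lia.
  have eu : u = 0.
    apply/eqP/negPn/negP => ne; have := depth_gt0 (term_depthseq a) (x := u).
    by move: h2; rewrite dv; lia.
  by apply/or3P/Or33; rewrite eu ev.
apply/or3P/Or32/mapP; exists (u - nleaves a, v - nleaves a) => /=; last first.
  by rewrite !subnK.
apply/IHb; split; [lia | by case: h2 |].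
move=> z hz; have := h3 (z + nleaves a).
by rewrite !ltnNge av leq_addl /= addnK ltnS; apply; lia.
Qed.

Lemma gedgesP t u v : ((u, v) \in gedges t) = [&& 0 < v < nleaves t & u == par (term_depth t) v].
Proof.
have dT := term_depthseq t; apply/idP/idP => [/gedges_preorder[h1 h2 h3]|/andP[hv /eqP ->]].
  apply/andP; split; first lia.
  apply/eqP/esym/(par_eq dT); [by case/andP: h1 | | by []].
  apply/(ancP dT); split; first by case/andP: h1 => /ltnW.
  by move=> z hz; case: (eqVneq z v) => [->|ne]; [lia | have := h3 z; lia].
have [p1 p2 p3] := parP dT hv.
apply/gedges_preorder; split => //; first lia.
by move=> z hz; case/(ancP dT): p3 => _ /(_ z); lia.
Qed.

Section TermTree.
Variable t : bterm.
Local Notation n := (nleaves t).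
Local Notation d := (term_depth t).
Let dT := term_depthseq t.

Lemma walkbP u v k : u < n -> walkb (gedges t) u v k ->
  [/\ v < n, anc d u v & d v = d u + k].
Proof.
elim: k u => [|k IH] u un /=; first by move/eqP <-; split; rewrite ?addn0 ?(anc_refl dT).
case/hasP => -[e1 e2] /=; rewrite gedgesP => /andP[hv /eqP ->] /andP[/eqP eu].
have [p1 p2 p3] := parP dT hv.
move/IH => /(_ ltac:(lia))[h1 h2 h3]; rewrite eu in p1 p2 p3.
by split => //; [apply: (anc_trans dT p3 h2) | rewrite h3; lia].
Qed.

Lemma walkb_anc u v : v < n -> anc d u v -> walkb (gedges t) u v (d v - d u).
Proof.
move=> vn; have [k ek] : exists k, k = d v - d u by exists (d v - d u).
rewrite -ek; elim: k u ek => [|k IH] u ek uv /=.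
  by apply/eqP/eqP/negPn/negP => ne; have := anc_depth_lt dT uv ne; lia.
have ku : (d u).+1 <= d v by lia.
have [e a] := upP dT vn ku; have := anc_leq dT a => lev.
have ua : anc d u (up d v (d u).+1) by apply: (anc_total dT uv a); lia.
have lua : u != up d v (d u).+1 by apply/eqP => h; rewrite -h in e; lia.
apply/hasP; exists (u, up d v (d u).+1).
  rewrite gedgesP; have := anc_leq dT ua => lu; apply/andP; split; first lia.
  by rewrite (par_eq dT _ ua) //; lia.
by rewrite /= eqxx; apply: IH => //; lia.
Qed.

Lemma tdescE x y : x < n -> tdesc t x y = (y < n) && anc d x y.
Proof.
move=> xn; apply/hasP/andP => [[k _ /walkbP[] //]|[yn xy]].
exists (d y - d x); last exact: walkb_anc.
by rewrite mem_iota; have := depth_leq dT yn; lia.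
Qed.

Lemma tdistE x y : x < n -> y < n -> anc d x y -> tdist t x y = d y - d x.
Proof.
move=> xn yn xy; rewrite /tdist.
have hs : has (walkb (gedges t) x y) (iota 0 n) by have := tdescE y xn; rewrite yn xy.
have := nth_find 0 hs; rewrite has_find size_iota in hs.
rewrite nth_iota // add0n => /(walkbP xn)[_ _]; lia.
Qed.

Lemma depthE x : x < n -> depth t x = d x.
Proof.
by move=> xn; rewrite /depth tdistE ?(proj1 dT) ?subn0 ?(anc0 dT) // nleaves_gt0.
Qed.

Lemma sub_heightE x : x < n -> sub_height t x = hgt n d x.
Proof.
move=> xn; rewrite /sub_height /hgt big_seq_cond [RHS]big_seq_cond.
have e y : (y \in iota 0 n) && tdesc t x y = (y \in iota 0 n) && anc d x y.
  by rewrite tdescE // mem_iota add0n; case: (y < n).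
rewrite (eq_bigl _ _ e); apply: eq_bigr => y.
by rewrite mem_iota add0n => /andP[yn xy]; rewrite tdistE.
Qed.

Lemma heightE : height t = hgt n d 0.
Proof. by rewrite /height sub_heightE // nleaves_gt0. Qed.

Lemma tparentE x : x < n -> tparent t x = if 0 < x then Some (par d x) else None.
Proof.
move=> xn; rewrite /tparent.
have h e : e \in gedges t -> e.2 == x -> 0 < x /\ e.1 = par d x.
  case: e => u v; rewrite gedgesP /= => /andP[hv /eqP ->] /eqP <-.
  by split => //; case/andP: hv.
case es : [seq e <- gedges t | e.2 == x] => [|e s].
  rewrite /=; case: ifP => // x0.
  have : (par d x, x) \in [seq e <- gedges t | e.2 == x].
    by rewrite mem_filter eqxx gedgesP x0 xn eqxx.
  by rewrite es.
have : e \in [seq e <- gedges t | e.2 == x] by rewrite es mem_head.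
by rewrite mem_filter => /andP[e2 eg] /=; have [-> ->] := h _ eg e2.
Qed.

Lemma sub_edgesE x u v : x < n ->
  ((u, v) \in sub_edges t x) = [&& v < n, anc d x v, v != x & u == par d v].
Proof.
move=> xn; rewrite mem_filter /= !tdescE // gedgesP.
apply/idP/idP.
  move=> /andP[/andP[/andP[un xu] /andP[vn xv]] /andP[hv /eqP e]].
  rewrite vn xv e eqxx andbT /=; apply/eqP => evx.
  by have := anc_leq dT xu; have := par_lt dT hv; lia.
case/and4P => vn xv ne /eqP ->; have lxv := anc_leq dT xv.
have hv : 0 < v < n by lia.
rewrite xv hv vn eqxx !andbT (anc_par dT vn xv) 1?eq_sym // andbT.
by have := par_lt dT hv; lia.
Qed.

End TermTree.

Lemma subtree_eqE t t' x : nleaves t' = nleaves t -> x < nleaves t ->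
  subtree_eq t t' x <-> same_subtree (nleaves t) (term_depth t) (term_depth t') x.
Proof.
move=> en xn; have dT := term_depthseq t; have dT' := term_depthseq t'; rewrite en in dT'.
have xn' : x < nleaves t' by rewrite en.
split => [[hd he]|hs].
  have ea y : y < nleaves t -> anc (term_depth t) x y = anc (term_depth t') x y.
    by move=> yn; have := hd y; rewrite !tdescE // en yn.
  suff h y : y < nleaves t -> anc (term_depth t) x y ->
      term_depth t y + term_depth t' x = term_depth t' y + term_depth t x.
    by move=> y yn; split; [exact: ea | exact: h].
  move: y; apply: (anc_ind dT); first lia.
  move=> y yn xy ltxy xp IH; have hy : 0 < y < nleaves t by lia.
  have := he (par (term_depth t) y, y); rewrite !sub_edgesE // eqxx yn xy en yn -ea // xy.
  rewrite neq_ltn ltxy orbT /= => /esym/eqP ep.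
  have := par_depth dT hy; have := par_depth dT' hy; rewrite -ep; lia.
split.
  move=> y; rewrite !tdescE // en; case: ltnP => //= yn.
  by have [] := hs y yn.
move=> [u v]; rewrite !sub_edgesE // en; case: ltnP => //= vn.
have [<- _] := hs v vn; have [xv|//] := boolP (anc (term_depth t) x v).
case: eqVneq => //= ne; rewrite (sub_par dT dT' hs vn xv) //.
by rewrite eq_sym.
Qed.

(** * Evaluation in the graph algebra *)

Section Evaluation.
Context {V : Type} (E : V -> V -> Prop).

Lemma beval_Some (a : nat -> option V) off t v :
  beval (gmul E) a off t = Some v <->
  [/\ a off = Some v, (forall i, i < nleaves t -> a (off + i) <> None) &
    forall e, e \in gedges t -> gmul E (a (off + e.1)) (a (off + e.2)) <> None].
Proof.
elim: t off v => [|t1 IH1 t2 IH2] off v /=.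
  split => [av|[]//]; split => // i; rewrite ltnS leqn0 => /eqP ->.
  by rewrite addn0 av.
have n1 := nleaves_gt0 t1; have n2 := nleaves_gt0 t2.
split.
  case e1 : (beval (gmul E) a off t1) => [u1|//].
  case e2 : (beval (gmul E) a (off + nleaves t1) t2) => [u2|//] /=.
  case: ifP => // /asboolP u12 [<-].
  have [a1 b1 c1] := proj1 (IH1 _ _) e1; have [a2 b2 c2] := proj1 (IH2 _ _) e2.
  split => //.
    move=> i hi; have [i1|i1] := ltnP i (nleaves t1); first exact: b1.
    have := b2 (i - nleaves t1); rewrite -addnA subnKC //; apply; lia.
  move=> e; rewrite !mem_cat inE => /or3P[/c1//|/mapP[e' /c2 h ->] /=|/eqP -> /=].
    by rewrite ![_ + nleaves t1]addnC !addnA.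
  by rewrite addn0 a1 a2 /=; case: asboolP.
move=> [av hN hE].
have -> : beval (gmul E) a off t1 = Some v.
  apply/IH1; split => // [i hi|e he]; first by apply: hN; lia.
  by apply: hE; rewrite mem_cat he.
case e2 : (a (off + nleaves t1)) => [u|]; last by case: (hN (nleaves t1)); [lia|].
have -> : beval (gmul E) a (off + nleaves t1) t2 = Some u.
  apply/IH2; split => // [i hi|e he]; first by rewrite -addnA; apply: hN; lia.
  rewrite -!addnA ![nleaves t1 + _]addnC.
  apply: (hE (e.1 + nleaves t1, e.2 + nleaves t1)).
  by rewrite !mem_cat; apply/or3P/Or32/mapP; exists e.
have := hE (0, nleaves t1); rewrite /= addn0 av e2 /=.
case: asboolP => // _ h; exfalso; apply: h => //.
by rewrite !mem_cat inE eqxx !orbT.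
Qed.

Lemma gmul_Some u v : gmul E (Some u) (Some v) <> None <-> E u v.
Proof. by rewrite /=; case: asboolP. Qed.

Lemma satisfies_tree_hom t t' : nleaves t' = nleaves t ->
  satisfies E t t' <->
  forall phi, tree_hom E (nleaves t) (term_depth t) phi <->
    tree_hom E (nleaves t) (term_depth t') phi.
Proof.
move=> en; have n0 := nleaves_gt0 t; split => [sat phi|h a].
  pose a i := Some (phi i).
  have aux s : nleaves s = nleaves t ->
      beval (gmul E) a 0 s = Some (phi 0) <-> tree_hom E (nleaves t) (term_depth s) phi.
    move=> es; rewrite beval_Some; split => [[_ _ h] x hx|h].
      apply/gmul_Some; apply: (h (par (term_depth s) x, x)).
      by rewrite gedgesP es hx eqxx.
    split => // -[u v]; rewrite gedgesP es => /andP[hv /eqP ->].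
    by apply/gmul_Some/h.
  by rewrite -(aux t erefl) -(aux t' en) sat.
have aux s s' : nleaves s = nleaves t -> nleaves s' = nleaves t ->
    (forall phi, tree_hom E (nleaves t) (term_depth s) phi ->
       tree_hom E (nleaves t) (term_depth s') phi) ->
    forall v, beval (gmul E) a 0 s = Some v -> beval (gmul E) a 0 s' = Some v.
  move=> es es' hh v /beval_Some[av hN hE]; apply/beval_Some.
  (* A finite value excludes infinity at every variable, so the default [v] is never taken on the
     leaves. *)
  pose phi i := odflt v (a i).
  have aphi i : i < nleaves t -> a i = Some (phi i).
    rewrite /phi => it; case e : (a i) => [u|] //.
    by exfalso; apply: (hN i); [rewrite es | rewrite add0n].
  have : tree_hom E (nleaves t) (term_depth s) phi.
    move=> x hx; apply/gmul_Some.
    have hs : 0 < x < nleaves s by rewrite es.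
    have := hE (par (term_depth s) x, x); rewrite gedgesP es hx eqxx => /(_ isT).
    by rewrite !add0n /= !aphi //; have := par_lt (term_depthseq s) hs; lia.
  move/hh => hs'; split => //; first by rewrite es' -es.
  move=> [u x]; rewrite gedgesP es' => /andP[hx /eqP ->] /=.
  have hs : 0 < x < nleaves s' by rewrite es'.
  rewrite !add0n !aphi; first by apply/gmul_Some/hs'.
    by case/andP: hx.
  by have := par_lt (term_depthseq s') hs; lia.
case e : (beval (gmul E) a 0 t) => [v|].
  by apply/esym; apply: (aux t t') e => // phi; rewrite h.
case e' : (beval (gmul E) a 0 t') => [v|//].
by rewrite -e; apply: (aux t' t) e' => // phi; rewrite h.
Qed.

End Evaluation.

Import Order.TTheory GRing.Theory Num.Theory.

(** * Extrema in the extended integers *)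

Section Extrema.
Local Open Scope ereal_scope.
Implicit Types P Q : nat -> Prop.

Lemma xmaxP (P : int -> Prop) m : P m -> (forall k, P k -> (k <= m)%R) ->
  xmax P = m%:E.
Proof.
move=> Pm hm; rewrite /xmax; case: pselect => [h|]; last by case; exists m.
congr EFin; have [g1 g2] := xgetPex 0%R h.
by apply/eqP; rewrite eq_le hm ?g2.
Qed.

Lemma xminP (P : int -> Prop) m : P m -> (forall k, P k -> (m <= k)%R) ->
  xmin P = m%:E.
Proof.
move=> Pm hm; rewrite /xmin; case: pselect => [h|]; last by case; exists m.
congr EFin; have [g1 g2] := xgetPex 0%R h.
by apply/eqP; rewrite eq_le hm ?g2.
Qed.

Variant xmax_natP_spec P : \bar int -> Prop :=
  | XmaxFin m of P m & (forall k, P k -> k <= m)%N : xmax_natP_spec P m%:Z%:E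
  | XmaxInf of (forall b, exists2 k, P k & b < k)%N : xmax_natP_spec P +oo
  | XmaxNone of (forall k, ~ P k) : xmax_natP_spec P -oo.

Lemma xmax_natP P : xmax_natP_spec P (xmax (natP P)).
Proof.
have [[b hb]|nb] := EM (exists b, forall k, P k -> k <= b)%N.
  have [ne|ne] := EM (exists k, P k); last first.
    rewrite /xmax; case: pselect => [[m [[k [em Pk]] hk]]|nx]; first by case: ne; exists k.
    case: pselect => [[m [k [em Pk]]]|nx2]; first by case: ne; exists k.
    by constructor => k Pk; apply: ne; exists k.
  have ne' : exists k, (fun k => `[< P k >]) k by have [k Pk] := ne; exists k; apply/asboolP.
  have hb' k : `[< P k >] -> (k <= b)%N by move/asboolP/hb.
  case: (ex_maxnP ne' hb') => m /asboolP Pm max.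
  rewrite (@xmaxP _ (m%:Z)%R); first by constructor => // k /asboolP/max.
    by exists m.
  by move=> z [k [-> /asboolP/max]]; rewrite lez_nat.
have inf b : exists2 k, P k & (b < k)%N.
  apply: contrapT => h; apply: nb; exists b => k Pk; rewrite leqNgt; apply/negP => bk.
  by apply: h; exists k.
rewrite /xmax; case: pselect => [[m [[k [em Pk]] h]]|nx].
  have [l Pl kl] := inf k; have := h (l%:Z)%R (ex_intro _ l (conj erefl Pl)).
  by move=> lm; exfalso; move: lm; rewrite em lez_nat leqNgt kl.
case: pselect => [ex|[]]; first by constructor.
by have [k Pk _] := inf 0%N; exists (k%:Z)%R, k.
Qed.

Variant xmin_natP_spec P : \bar int -> Prop :=
  | XminFin m of P m & (forall k, P k -> m <= k)%N : xmin_natP_spec P m%:Z%:E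
  | XminNone of (forall k, ~ P k) : xmin_natP_spec P +oo.

Lemma xmin_natP P : xmin_natP_spec P (xmin (natP P)).
Proof.
have [ne|ne] := EM (exists k, P k); last first.
  rewrite /xmin; case: pselect => [[m [[k [em Pk]] hk]]|nx]; first by case: ne; exists k.
  case: pselect => [[m [k [em Pk]]]|nx2]; first by case: ne; exists k.
  by constructor => k Pk; apply: ne; exists k.
have ne' : exists k, (fun k => `[< P k >]) k by have [k Pk] := ne; exists k; apply/asboolP.
case: (ex_minnP ne') => m /asboolP Pm min.
rewrite (@xminP _ (m%:Z)%R); first by constructor => // k /asboolP/min.
  by exists m.
by move=> z [k [-> /asboolP/min]]; rewrite lez_nat.
Qed.

Lemma xmax_natP_lt P b : xmax (natP P) < (b%:Z)%:E <-> forall k, P k -> (k < b)%N.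
Proof.
case: xmax_natP => [m Pm h|inf|none].
- rewrite lte_fin ltz_nat; split => [mb k /h|]; last exact.
  by move=> km; apply: leq_ltn_trans km mb.
- split => // h; have [k /h] := inf b; lia.
- by split => [_ k /none|_] //; rewrite ltNyr.
Qed.

Lemma xmax_natP_le P b : xmax (natP P) <= (b%:Z)%:E <-> forall k, P k -> (k <= b)%N.
Proof.
case: xmax_natP => [m Pm h|inf|none].
- rewrite lee_fin lez_nat; split => [mb k /h|]; last exact.
  by move=> km; apply: leq_trans km mb.
- split => // h; have [k /h] := inf b; lia.
- by split => [_ k /none|_] //; rewrite leNye.
Qed.

(** The boundedness clause matters when [Q] is empty: the right side is then [+oo], and [P] must
    still be bounded. *)
Lemma xmax_lt_xmin P Q : xmax (natP P) < xmin (natP Q) <->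
  (exists b, forall k, P k -> (k <= b)%N) /\ forall k l, P k -> Q l -> (k < l)%N.
Proof.
case: (xmin_natP Q) => [m Qm h|none].
  rewrite xmax_natP_lt; split => [hk|[_ hk] k Pk]; last exact: hk.
  split; first by exists m => k /hk/ltnW.
  by move=> k l /hk km /h; apply: leq_trans.
case: xmax_natP => [m Pm h|inf|none'].
- by split => // _; split; [exists m | move=> k l _ /none].
- by split => // -[[b hb] _]; have [k /hb] := inf b; lia.
- by split => // _; split; [exists 0%N => k /none' | move=> k l _ /none].
Qed.

Lemma xmax_threshold (P : int -> Prop) :
  (forall a b, (a <= b)%R -> P b -> P a) -> P (-1)%R -> (exists N : nat, ~ P (N%:Z)%R) ->
  exists y : nat, [/\ xmax P = (y%:Z - 1)%:E, P (y%:Z - 1)%R & ~ P (y%:Z)%R].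
Proof.
move=> down P1 [N nN].
have ne : exists y, (fun y => `[< ~ P (y%:Z)%R >]) y by exists N; apply/asboolP.
case: (ex_minnP ne) => y /asboolP ny min; exists y.
have Py : P (y%:Z - 1)%R.
  case: y ny min => [//|y] _ min; apply: contrapT => nP.
  have /asboolP/min : ~ P (y%:Z)%R; last by rewrite ltnn.
  by move=> Py; apply: nP; apply: down Py; rewrite -addn1 PoszD addrK.
split => //; apply: xmaxP => // k Pk; rewrite leNgt; apply/negP => yk.
by apply: ny; apply: down Pk; lia.
Qed.

End Extrema.

Lemma dvdn_absdiff m a b : m %| (a - b) + (b - a) <-> a = b %[mod m].
Proof.
case: (leqP a b) => [ab|/ltnW ba].
  have -> : a - b + (b - a) = b - a by lia.
  by rewrite -eqn_mod_dvd // eq_sym; split => /eqP.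
have -> : a - b + (b - a) = a - b by lia.
by rewrite -eqn_mod_dvd //; split => /eqP.
Qed.

(** * Graph parameters in terms of closed walks *)

Section GraphTranslation.
Context {V : Type} (E : V -> V -> Prop).

Lemma pleasantE w k :
  (is_path E w k /\ forall i, i <= k -> in_trivial_scc E (w i)) <-> pleasant E w k.
Proof.
split => [[[hw _] h]|[hw h]]; first by split => // i /h/in_trivialP.
split => [|i /h/in_trivialP//]; apply: walk_path => // i j ij [ci _].
by apply: (h i) => //; lia.
Qed.

Lemma entryE l : (exists w K, is_entryway E w l K) <-> exists w, entry E w l.
Proof.
split => [[w [K [[hw _] [h [ntK Kw]]]]]|[w [hw [h cw]]]].
  exists w; split => //; split => [i /h/in_trivialP//|].
  by have [] := nontrivial_sccP ntK Kw.
exists w, (scc E (w l)); split.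
  by apply: walk_path => // i j ij [ci _]; apply: (h i) => //; lia.
split => [i /h/in_trivialP//|].
by split; [apply: nontrivial_scc_cyc | apply: sc_refl].
Qed.

Lemma outletE l : (exists w K, is_outlet E w l K) <-> exists w, outlet E w l.
Proof.
split => [[w [K [[hw _] [ntK [Kw h]]]]]|[w [hw [cw h]]]]; exists w.
  split => //; split; first by have [] := nontrivial_sccP ntK Kw.
  by move=> i /h/in_trivialP.
exists (scc E (w 0)); split.
  by apply: walk_path => // i j ij [_ cj]; apply: (h j) => //; lia.
split; first exact: nontrivial_scc_cyc.
by split => [|i /h/in_trivialP//]; apply: sc_refl.
Qed.

Lemma in_ZGE m : (exists K p B i u w (f : nat -> V),
    is_scc E K /\ whirl_blocks E K p B /\ i < p /\ B i u /\ B i w /\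
    is_walk E f m.+1 /\ f 0 = u /\ ~ E w (f 1)) <-> in_ZG E m.
Proof.
split.
  move=> [K [p [B [i [u [w [f [sK [hB [ip [Bu [Bw h]]]]]]]]]]]].
  have [beta [W hb]] := whirl_blocks_index hB; have [_ [_ [sub _]]] := hB.
  exists K, p, beta, u, w, f; split => //; split => //.
  split; first exact: sub Bu.
  split; first exact: sub Bw.
  by rewrite (hb _ _ ip Bu) (hb _ _ ip Bw).
move=> [K [p [beta [u [w [f [sK [W [Ku [Kw [e h]]]]]]]]]]].
have p0 : 0 < p by case: W.
exists K, p, (fun i => [set u | K u /\ beta u = i %[mod p]]%classic), (beta u %% p), u, w, f.
split => //; split; first exact: whirl_index_blocks.
by rewrite ltn_pmod //= !modn_mod.
Qed.

Lemma in_BGE m : (exists (f : nat -> V) a b K K',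
    is_walk E f m /\ E (f m) a /\ E (f m) b /\
    nontrivial_scc E K /\ nontrivial_scc E K' /\ K <> K' /\ K a /\ K' b) <-> in_BG E m.
Proof.
split.
  move=> [f [a [b [K [K' [hf [fa [fb [nK [nK' [ne [Ka K'b]]]]]]]]]]]].
  have [ca eK] := nontrivial_sccP nK Ka; have [cb eK'] := nontrivial_sccP nK' K'b.
  exists f, a, b; do 5!split => //.
  by move=> ab; apply: ne; rewrite eK eK'; apply: scc_eq.
move=> [f [a [b [hf [fa [fb [ca [cb nab]]]]]]]].
exists f, a, b, (scc E a), (scc E b); do 3!split => //.
split; first exact: nontrivial_scc_cyc.
split; first exact: nontrivial_scc_cyc.
split; last by split; apply: sc_refl.
by move=> e; apply: nab; have : scc E a a := sc_refl E a; rewrite e.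
Qed.

Lemma in_omegaGE l r m : (exists f g : nat -> V,
    is_walk E f l /\ in_nontrivial_scc E (f l) /\
    g r.-1 = f r.-1 /\ (forall i, r.-1 <= i < m -> E (g i) (g i.+1)) /\
    l <= m /\ in_trivial_scc E (g l)) <-> in_omegaG E l r m.
Proof.
by split => -[f [g [h1 [h2 [h3 [h4 [h5 h6]]]]]]]; exists f, g; do !split => //;
  [apply/in_nontrivialP | apply/in_trivialP | apply/in_nontrivialP | apply/in_trivialP].
Qed.

Lemma in_lambdaGE e m : (exists (u : nat -> V) K w (v : nat -> V),
    is_entryway E u e K /\ K w /\ E w (u e) /\ is_walk E v m /\
    (E w (v 0) <-> ~ E (u e.-1) (v 0))) <-> in_lambdaG E e m.
Proof.
split.
  move=> [u [K [w [v [[[hu _] [h [ntK Ku]]] [Kw hh]]]]]].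
  have [cu eK] := nontrivial_sccP ntK Ku; exists u, w, v.
  split; last by split => //; move: Kw; rewrite eK.
  by split => //; split => // i /h/in_trivialP.
move=> [u [w [v [[hu [h cu]] [sw hh]]]]]; exists u, (scc E (u e)), w, v.
split; last by split.
split; first by apply: walk_path => // i j ij [ci _]; apply: (h i) => //; lia.
split => [i /h/in_trivialP//|].
by split; [apply: nontrivial_scc_cyc | apply: sc_refl].
Qed.

(** A cyclic vertex after the start would put [f 1] in the whirl, in the block following that of [u]
    and [w], and give the excluded edge. Outlets thus bound [Z_G]. *)
Lemma in_ZG_outlet m : scc_isolated E -> in_ZG E m -> exists g, outlet E g m.+1.
Proof.
move=> iso [K [p [beta [u [w [f [[v eK] [W [Ku [Kw [e [hf [f0 nE]]]]]]]]]]]]].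
have [_ [ed sur]] := W; have [z [Kz ez]] := sur (beta u).+1.
have uz : E u z by apply/(ed u z Ku Kz).
have scu z' : sc E z' u -> K z'.
  by move=> zu; move: Ku; rewrite eK => uv; apply: (sc_trans zu uv).
have zu : reach E z u.
  by move: Ku Kz; rewrite eK => -[a b] [c f']; apply: reach_trans c b.
have cu : cyc E u := edge_back_cyc uz zu.
exists f; split => //; rewrite f0; split => // i hi ci; apply: nE.
have r1 : reach E u (f 1) by rewrite -f0; apply/reach_edge/hf.
have r2 : reach E (f 1) (f i) by apply: (walk_reach hf); lia.
have K1 : K (f 1).
  apply: scu; split => //; apply: (reach_trans r2); apply: iso => //.
  exact: reach_trans r1 r2.
have u1 : E u (f 1) by rewrite -f0; apply: hf.
apply: (whirl_edge W Kw K1).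
by apply: (eqmod_add2 (esym (whirl_edgeE W Ku K1 u1)) (esym e)); clear; lia.
Qed.

Lemma whirl_period_dvd M : 0 < M -> (forall m, whirl_period E m -> m %| M) ->
  exists2 g, MG E = Some g & g %| M.
Proof.
move=> M0 h; have ub : exists b, forall m, whirl_period E m -> m <= b.
  by exists M => m /h; apply: dvdn_leq.
rewrite /MG; case: pselect => // ?.
exists (\big[lcmn/1]_(m < (xget 0 [set b | forall m, whirl_period E m -> m <= b]%classic).+1
  | `[< whirl_period E m >]) (m : nat)) => //.
by apply/dvdn_biglcmP => m /asboolP/h.
Qed.

Lemma dvd_whirl_period g m : MG E = Some g -> whirl_period E m -> m %| g.
Proof.
rewrite /MG; case: pselect => // ub [<-] wm.
have /(_ _ wm) := xgetPex 0 ub => mb.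
by apply: (@biglcmn_sup _ (Ordinal (mb : m < _.+1))) => //; apply/asboolP.
Qed.

End GraphTranslation.

(** * Term parameters in terms of depth sequences *)

Section TermTranslation.
Variables t t' : bterm.
Hypothesis en : nleaves t' = nleaves t.
Local Notation n := (nleaves t).
Local Notation d := (term_depth t).
Local Notation d' := (term_depth t').

Let dT := term_depthseq t.
Let dT' : depthseq n d'. Proof. by rewrite -en; apply: term_depthseq. Qed.

Let depthE' x : x < n -> depth t' x = d' x.
Proof. by rewrite -en; apply: depthE. Qed.

Let sub_heightE' x : x < n -> sub_height t' x = hgt n d' x.
Proof. by rewrite -en; apply: sub_heightE. Qed.

Lemma tHE : tH t t' = minn (hgt n d 0) (hgt n d' 0).
Proof. by rewrite /tH !heightE en. Qed.

Lemma dvdn_tM m : m %| tM t t' <-> forall x, x < n -> d x = d' x %[mod m].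
Proof.
rewrite /tM; split.
  move=> /dvdn_biggcdP h x xn; have := h (Ordinal xn) isT.
  by rewrite /= depthE // depthE' // => /dvdn_absdiff.
move=> h; apply/dvdn_biggcdP => -[x xn] _ /=.
by rewrite depthE // depthE' //; apply/dvdn_absdiff/h.
Qed.

Hypothesis diff : exists2 x, x < n & d x <> d' x.

Lemma tM_gt0 : 0 < tM t t'.
Proof.
rewrite lt0n; apply/eqP => e; have [x xn dx] := diff.
have /dvdn_tM/(_ x xn) : 0 %| tM t t' by rewrite e.
by rewrite !modn0.
Qed.

Lemma root_not_same : ~ same_subtree n d d' 0.
Proof.
move=> h; have [x xn dx] := diff; apply: dx; have [_ /(_ (anc0 dT xn))] := h x xn.
by rewrite !term_depth0 !addn0.
Qed.

Lemma tL_spec : exists l : nat, [/\ tL t t' = (l%:Z)%:E%E,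
  (forall x, x < n -> d x <= l \/ d' x <= l -> d x = d' x) &
  exists2 x, x < n & d x <> d' x /\ (d x = l.+1 \/ d' x = l.+1)].
Proof.
pose P (m : int) := forall x, x < n ->
  ((depth t x)%:Z <= m \/ (depth t' x)%:Z <= m)%R -> depth t x = depth t' x.
have [|||[|l] [e Pl nPl]] := @xmax_threshold P.
- by move=> a b ab Pb x xn h; apply: Pb => //; case: h => h; [left|right]; lia.
- by move=> x xn [] h; lia.
- exists n => h; have [x xn] := diff; apply; rewrite -depthE // -depthE' //.
  by apply: h => //; left; rewrite depthE // lez_nat ltnW // (leq_ltn_trans (depth_leq dT xn)).
(* The threshold is not zero, since the root is the only vertex of depth 0 in either tree. *)
- case: nPl => x xn; rewrite depthE // depthE' // !lez_nat !leqn0 => h.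
  have ex0 : x = 0.
    apply/eqP/negPn/negP; rewrite -lt0n => x0.
    have := depth_gt0 dT (x := x); have := depth_gt0 dT' (x := x).
    by case: h => /eqP ->; rewrite x0 xn => h1 h2; [have := h2 isT | have := h1 isT].
  by rewrite ex0 !term_depth0.
have el : (l.+1%:Z - 1 = l%:Z)%R by lia.
rewrite el in e Pl; exists l; split => //.
  by move=> x xn h; rewrite -depthE // -depthE' //; apply: Pl => //;
     rewrite depthE // depthE' // !lez_nat.
apply: contrapT => nx; apply: nPl => x xn; rewrite depthE // depthE' // !lez_nat => h.
apply: contrapT => dx; apply: nx; exists x => //; split => //.
have hl : ~ (d x <= l \/ d' x <= l).
  by move=> h'; apply: dx; rewrite -depthE // -depthE' //; apply: Pl => //;
     rewrite depthE // depthE' // !lez_nat.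
case: h => h; [left|right]; apply/eqP; rewrite eqn_leq h /= ltnNge; apply/negP => h'; apply: hl.
  by left.
by right.
Qed.

(** [tY] is [-1] when a leaf of one tree is not a leaf of the other, so the natural number [y]
    stands for [tY + 1]. *)
Lemma tY_spec : exists y : nat, [/\ (tY t t' + 1 = (y%:Z)%:E)%E,
  (forall x, x < n -> hgt n d x < y \/ hgt n d' x < y -> same_subtree n d d' x) &
  exists2 x, x < n & (hgt n d x <= y \/ hgt n d' x <= y) /\ ~ same_subtree n d d' x].
Proof.
pose P (m : int) := forall x, x < n ->
  ((sub_height t x)%:Z <= m \/ (sub_height t' x)%:Z <= m)%R -> subtree_eq t t' x.
have n0 : 0 < n := nleaves_gt0 t.
have [|||y [e Py nPy]] := @xmax_threshold P.
- by move=> a b ab Pb x xn h; apply: Pb => //; case: h => h; [left|right]; lia.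
- by move=> x xn [] h; lia.
- exists (sub_height t 0) => h; apply: root_not_same; apply/(subtree_eqE en n0).
  by apply: h => //; left.
exists y; split.
- by rewrite /tY e -EFinD; congr EFin; lia.
- move=> x xn h; apply/(subtree_eqE en xn)/Py => //.
  by rewrite sub_heightE // sub_heightE' //; case: h => h; [left|right]; lia.
apply: contrapT => nx; apply: nPy => x xn; rewrite sub_heightE // sub_heightE' // !lez_nat => h.
by apply/(subtree_eqE en xn); apply: contrapT => ns; apply: nx; exists x.
Qed.

(** The root has no parent in either tree, so parents can differ only for [0 < x]. *)
Definition in_tZ m := exists x, [/\ 0 < x < n, same_subtree n d d' x, hgt n d x = m
  & par d x <> par d' x].

Lemma in_tZE m : (exists x, x < n /\ subtree_eq t t' x /\
    sub_height t x = m /\ tparent t x <> tparent t' x) <-> in_tZ m.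
Proof.
split => -[x].
  move=> [xn [sx [<- ne]]]; exists x; move: ne; rewrite !tparentE ?en //.
  case: ifP => // x0 ne; rewrite sub_heightE //; split => //.
    exact/(subtree_eqE en xn).
  by move=> e; apply: ne; rewrite e.
move=> [/andP[x0 xn] sx <- ne]; exists x; split => //.
split; first exact/(subtree_eqE en xn).
by rewrite sub_heightE // !tparentE ?en // x0; split => // -[].
Qed.

Lemma inOmegaE p : inOmega t t' p <-> exists x, [/\ x < n, ~ same_subtree n d d' x &
  p = (d x, hgt n d x) \/ p = (d' x, hgt n d' x)].
Proof.
split => [[x [xn [ns h]]]|[x [xn ns h]]]; exists x.
  rewrite -depthE // -depthE' // -sub_heightE // -sub_heightE' //; split => //.
  by move/(subtree_eqE en xn).
rewrite depthE // depthE' // sub_heightE // sub_heightE' //; split => //; split => //.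
by move/(subtree_eqE en xn).
Qed.

(* When [xi <= r], a pair attaining the minimum [xi] automatically has depth at
   most [r], so both branches of the definition give the same minimum. *)
Lemma tomega_spec r : exists s : nat, [/\ tomega t t' r = (s%:Z)%:E%E,
  (exists p, [/\ inOmega t t' p, p.1 <= r & s = p.1 + p.2]) &
  (forall p, inOmega t t' p -> p.1 <= r -> s <= p.1 + p.2)].
Proof.
have root : inOmega t t' (d 0, hgt n d 0).
  apply/inOmegaE; exists 0; split; [exact: nleaves_gt0 | exact: root_not_same | by left].
rewrite /tomega; case exi : (txi t t') => [z| |]; first last.
- by move: exi; rewrite /txi; case: xmin_natP.
- move: exi; rewrite /txi; case: xmin_natP => // /(_ (d 0 + hgt n d 0)).
  by case; exists (d 0, hgt n d 0).
have [x [ex [p [hp sp]] xmin']] : exists x : nat, [/\ z = (x%:Z)%R,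
    exists p, inOmega t t' p /\ x = p.1 + p.2 &
    forall p, inOmega t t' p -> x <= p.1 + p.2].
  move: exi; rewrite /txi; case: xmin_natP => // x [p hp] h [<-]; exists x; split => //.
    by exists p.
  by move=> p' hp'; apply: h; exists p'.
rewrite ex lte_fin ltz_nat; case: ltnP => rx.
  case: xmin_natP => [s [p' [h1 [h2 h3]]] h|none]; last first.
    by case: (none (d 0 + hgt n d 0)); exists (d 0, hgt n d 0); split => //=; rewrite term_depth0.
  exists s; split => //; first by exists p'.
  by move=> p'' h4 h5; apply: h; exists p''.
exists x; split => //.
  by exists p; split => //; lia.
by move=> p' h1 _; apply: xmin'.
Qed.

Definition in_tlambda l m := exists x, [/\ x < n, d x <> d' x, d x = l.+1 \/ d' x = l.+1
  & m = maxn (hgt n d x) (hgt n d' x)].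

Lemma in_tlambdaE (l m : nat) : tL t t' = (l%:Z)%:E%E ->
  (exists x, x < n /\ depth t x <> depth t' x /\
    ((depth t x)%:Z%:E = tL t t' + 1 \/ (depth t' x)%:Z%:E = tL t t' + 1)%E /\
    m = maxn (sub_height t x) (sub_height t' x)) <-> in_tlambda l m.
Proof.
move=> eL; have eS (k : nat) : ((k%:Z)%:E = tL t t' + 1)%E <-> k = l.+1.
  rewrite eL -EFinD; split; first by case; lia.
  by move=> ->; congr EFin; lia.
split => [[x [xn [dx [lx ->]]]]|[x [xn dx lx ->]]]; exists x.
  move: dx lx; rewrite !eS depthE // depthE' // sub_heightE // sub_heightE' //.
by rewrite !eS depthE // depthE' // sub_heightE // sub_heightE'.
Qed.

End TermTranslation.

Theorem theorem6p31 (V : Type) (E : V -> V -> Prop) (n : nat) (t t' : bterm)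
  (ht : in_B n t) (ht' : in_B n t') (htt : t <> t') :
  satisfies E t t' <->
  ( (* (i) *) (forall K, nontrivial_scc E K -> is_whirl E K) /\
    (* (ii) *) (~ exists K K' (w : nat -> V) k,
                  nontrivial_scc E K /\ nontrivial_scc E K' /\ K <> K' /\
                  is_path E w k /\ K (w 0) /\ K' (w k)) /\
    (* (iii) *) (match MG E with Some g => (g %| tM t t')%N | None => False end) /\
    (* (iv) *) (PG E < ((tH t t')%:Z)%:E)%E /\
    (* (v) *) (EG E <= tL t t' + 1)%E /\
    (* (vi) *) (OG E <= tY t t' + 1)%E /\
    (* (vii) *) (ZG E < tZ t t')%E /\
    (* (viii) *) (BG E < tL t t')%E /\
    (* (ix) *) (forall l : nat, tL t t' = (l%:Z)%:E ->
                forall r : nat, (0 < r <= l.+1)%N ->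
                (omegaG E l.+1 r < tomega t t' r)%E) /\
    (* (x) *) (EG E = tL t t' + 1 -> lambdaG E < tlambda t t')%E ).
Proof.
move: ht ht'; rewrite /in_B => <- en {n}.
have diff : exists2 x, x < nleaves t & term_depth t x <> term_depth t' x.
  apply: contrapT => nd; apply: htt; apply: term_depth_inj => // x xn.
  by apply: contrapT => ne; apply: nd; exists x.
split.
  move=> /(satisfies_tree_hom E en) sat.
  have dT := term_depthseq t.
  have dT' : depthseq (nleaves t) (term_depth t') by rewrite -en; apply: term_depthseq.
  have [l [eL lev [x0 x0n [dx0 lx0]]]] := tL_spec en diff.
  have [y [eY _ [y0 y0n [hy0 ny0]]]] := tY_spec en diff.
  have n0 : 0 < nleaves t := nleaves_gt0 t.
  have nroot := root_not_same diff.
  have hO := tomega_spec en diff.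
  have hOm := inOmegaE en.
  have hLt m := in_tlambdaE en m eL.
  have hZt := in_tZE en.
  have hMd := dvdn_tM en.
  have hM0 := tM_gt0 en diff.
  have hH := tHE en.
  set n := nleaves t in dT dT' lev x0n y0n hy0 ny0 diff sat n0 nroot hOm hLt hZt hMd hH.
  set d := term_depth t in dT lev dx0 lx0 hy0 ny0 diff sat nroot hOm hLt hZt hMd hH.
  set d' := term_depth t' in dT' lev dx0 lx0 hy0 ny0 diff sat nroot hOm hLt hZt hMd hH.
  have lev' x : x < n -> d' x <= l \/ d x <= l -> d' x = d x.
    by move=> xn h; rewrite lev //; case: h; [right|left].
  have eL1 : (tL t t' + 1 = (l.+1%:Z)%:E)%E by rewrite eL -EFinD; congr EFin; lia.
  have dd' phi : tree_hom E n d phi -> tree_hom E n d' phi by move/sat.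
  have d'd phi : tree_hom E n d' phi -> tree_hom E n d phi by move/sat.
  have diff' : exists2 x, x < n & d' x <> d x.
    by have [x xn ne] := diff; exists x => // e; apply: ne.
  have iso := nec_isolated dT dT' dd' d'd diff.
  have whirls := nec_whirl dT dT' dd' d'd diff.
  have ent w k : entry E w k -> k <= l.+1.
    case: lx0 => lx0.
      by apply: (entry_le dT dT' dd' lev x0n lx0) => e; apply: dx0; rewrite lx0.
    by apply: (entry_le dT' dT d'd lev' x0n lx0) => e; apply: dx0; rewrite lx0.
  have out g k x : outlet E g k.+1 -> x < n -> hgt n d x <= k \/ hgt n d' x <= k ->
      same_subtree n d d' x.
    move=> hg xn [h|h]; first exact: (nec_outlet dT dT' dd' d'd hg xn h).
    exact: sub_sym (nec_outlet dT' dT d'd dd' hg xn h).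
  split.
    move=> K nK; have [[v eK] _] := nK; have Kv : K v by rewrite eK; apply: sc_refl.
    have [cv ->] := nontrivial_sccP nK Kv; have [p [beta W]] := whirls v cv.
    by exists p; eexists; apply: whirl_index_blocks W.
  split.
    move=> [K [K' [w [k [nK [nK' [ne [[hw _] [Kw K'w]]]]]]]]].
    have [c0 eK] := nontrivial_sccP nK Kw; have [ck eK'] := nontrivial_sccP nK' K'w.
    have r : reach E (w 0) (w k) by apply: (walk_reach hw); rewrite leqnn.
    by apply: ne; rewrite eK eK'; apply: scc_eq; split => //; apply: iso.
  split.
    have [|g -> //] := whirl_period_dvd hM0 (E := E).
    move=> m [K [sK [B hB]]]; apply/hMd.
    have [beta [W _]] := whirl_blocks_index hB.
    exact: (whirl_depth dT dT' dd' W).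
  split.
    apply/xmax_natP_lt => k [w /pleasantE pw]; rewrite hH leq_min.
    rewrite (nec_pleasant dT dT' dd' d'd diff pw).
    by rewrite (nec_pleasant dT' dT d'd dd' diff' pw).
  split.
    by rewrite eL1; apply/xmax_natP_le => k /entryE[w /ent].
  split.
    rewrite eY; apply/xmax_natP_le => k /outletE[g hg]; rewrite leqNgt; apply/negP => yk.
    case: k hg yk => // k hg yk; apply: ny0; apply: (out g k y0 hg) => //.
    by case: hy0 => h; [left|right]; apply: leq_trans h _.
  split.
    apply/xmax_lt_xmin; split.
      (* A finite bound is required even when [tZ] is infinite: a longer walk would be an outlet
         forcing equal subtrees at the root. *)
      exists (hgt n d 0) => m /in_ZGE/(in_ZG_outlet iso)[g hg]; rewrite leqNgt; apply/negP => hm.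
      by apply: nroot; exact: (out g m 0 hg n0 (or_introl (ltnW hm))).
    move=> m k /in_ZGE hm /hZt[x [hx sx <- ne]].
    exact: (in_ZG_lt dT dT' dd' hm hx ne).
  split.
    rewrite eL; apply/xmax_natP_lt => m /in_BGE hm.
    case: lx0 => lx0.
      by apply: (in_BG_lt dT dT' dd' lev iso x0n lx0 _ hm) => e; apply: dx0; rewrite lx0.
    by apply: (in_BG_lt dT' dT d'd lev' iso x0n lx0 _ hm) => e; apply: dx0; rewrite lx0.
  split.
    move=> l'; rewrite eL => -[<-] r hr; have [s [-> [p [hp pr ->]] _]] := hO r.
    apply/xmax_natP_lt => m /in_omegaGE hm; have [x [xn ns hpx]] := proj1 (hOm p) hp.
    have ns' : ~ same_subtree n d' d x by move=> h; apply/ns/sub_sym.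
    case: hpx pr => -> /= pr.
      exact: (nec_omega dT dT' dd' d'd diff lev ent hr hm xn ns pr).
    exact: (nec_omega dT' dT d'd dd' diff' lev' ent hr hm xn ns' pr).
  rewrite eL1 => eG; rewrite /lambdaG eG; apply/xmax_lt_xmin.
  have Lb m x : in_lambdaG E l.+1 m -> x < n -> d x <> d' x -> d x = l.+1 \/ d' x = l.+1 ->
      m < maxn (hgt n d x) (hgt n d' x).
    move=> hm xn dx [lx|lx].
      by apply: (in_lambdaG_lt dT dT' dd' lev d'd whirls xn lx _ hm) => e; apply: dx; rewrite lx.
    rewrite maxnC.
    by apply: (in_lambdaG_lt dT' dT d'd lev' dd' whirls xn lx _ hm) => e; apply: dx; rewrite lx.
  split.
    by exists (maxn (hgt n d x0) (hgt n d' x0)) => m /in_lambdaGE hm; apply/ltnW/Lb.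
  by move=> m k /in_lambdaGE hm /hLt[x [xn dx lx ->]]; apply: Lb.
move=> [c1 [c2 [c3 [c4 [c5 [c6 [c7 [c8 [c9 c10]]]]]]]]].
have dT := term_depthseq t.
have dT' : depthseq (nleaves t) (term_depth t') by rewrite -en; apply: term_depthseq.
have [l [eL lev wit]] := tL_spec en diff.
have [y [eY hY _]] := tY_spec en diff.
set n := nleaves t in dT dT' lev wit hY diff *; set d := term_depth t in dT lev wit hY diff *.
set d' := term_depth t' in dT' lev wit hY diff *.
have eL1 : (tL t t' + 1 = (l.+1%:Z)%:E)%E by rewrite eL -EFinD; congr EFin; lia.
have whirls v : cyc E v -> exists p beta, whirl_index E (scc E v) p beta.
  move=> cv; have [p [B hB]] := c1 _ (nontrivial_scc_cyc cv); exists p.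
  by have [beta [W _]] := whirl_blocks_index hB; exists beta.
have iso : scc_isolated E.
  move=> u v cu cv uv; apply: contrapT => nvu; apply: c2.
  have [w [k [hw [w0 wk]]]] := reach_path uv.
  exists (scc E u), (scc E v), w, k.
  split; first exact: nontrivial_scc_cyc.
  split; first exact: nontrivial_scc_cyc.
  split; last by rewrite w0 wk; split; [exact: hw | split; apply: sc_refl].
  move=> e; have : scc E v v := sc_refl E v.
  by rewrite -e => -[].
have cong v p beta : whirl_index E (scc E v) p beta ->
    forall x, x < n -> d x = d' x %[mod p].
  move=> W; apply/(dvdn_tM en); case eM : (MG E) c3 => [g|//]; apply: dvdn_trans.
  apply: (dvd_whirl_period eM); exists (scc E v); split; first by exists v.
  by eexists; apply: whirl_index_blocks W.
have pl w k : pleasant E w k -> k < hgt n d 0 /\ k < hgt n d' 0.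
  move=> pw; apply/andP; rewrite -leq_min -(tHE en).
  by move: c4 => /xmax_natP_lt; apply; exists w; apply/pleasantE.
have ent w k : entry E w k -> k <= l.+1.
  move=> hw; move: c5; rewrite eL1 => /xmax_natP_le; apply.
  by apply/entryE; exists w.
have out g k x : outlet E g k.+1 -> x < n -> hgt n d x <= k \/ hgt n d' x <= k ->
    same_subtree n d d' x.
  move=> hg xn hk; apply: hY => //; have : k.+1 <= y; last by case: hk; [left|right]; lia.
  by move: c6; rewrite eY => /xmax_natP_le; apply; apply/outletE; exists g.
have Zb m x : in_ZG E m -> 0 < x < n -> same_subtree n d d' x -> par d x <> par d' x ->
    m < hgt n d x.
  move=> hm hx sx ne; move: c7 => /xmax_lt_xmin[_]; apply; first exact/in_ZGE.
  by apply/(in_tZE en); exists x.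
have Bb m : in_BG E m -> m < l.
  by move=> hm; move: c8; rewrite eL => /xmax_natP_lt; apply; apply/in_BGE.
have Ob r m x : 0 < r <= l.+1 -> in_omegaG E l.+1 r m -> x < n -> ~ same_subtree n d d' x ->
    (d x <= r -> m < d x + hgt n d x) /\ (d' x <= r -> m < d' x + hgt n d' x).
  move=> hr hm xn ns; have [s [es _ min]] := tomega_spec en diff r.
  have ms : m < s.
    have := c9 l eL r hr; rewrite es => /xmax_natP_lt; apply.
    exact/in_omegaGE.
  have hO p : (p = (d x, hgt n d x) \/ p = (d' x, hgt n d' x)) -> p.1 <= r -> m < p.1 + p.2.
    by move=> hp hpr; apply: leq_trans ms (min _ _ hpr); apply/(inOmegaE en); exists x.
  by split; [apply: (hO (d x, _)); left | apply: (hO (d' x, _)); right].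
have Lb m x : in_lambdaG E l.+1 m -> x < n -> d x <> d' x -> d x = l.+1 \/ d' x = l.+1 ->
    m < maxn (hgt n d x) (hgt n d' x).
  move=> hm xn dx lx; have [u [w [v [hu hh]]]] := hm.
  (* A witness for [lambda_G] contains an entry of length [L + 1], so [E_G] is [L + 1] and condition
     (x) is in force. *)
  have eG : EG E = (l.+1%:Z)%:E.
    apply: xmaxP; first by exists l.+1; split => //; apply/entryE; exists u.
    by move=> _ [k [-> /entryE[w' /ent]]]; rewrite lez_nat.
  have := c10; rewrite eL1 => /(_ eG); rewrite /lambdaG eG => /xmax_lt_xmin[_]; apply.
    exact/in_lambdaGE.
  by apply/(in_tlambdaE en _ eL); exists x.
apply/(satisfies_tree_hom E en) => phi; split.
  apply: (sufficiency dT dT' lev whirls iso cong _ ent _ Zb Bb _ Lb wit).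
  - by move=> w k /pl[].
  - by move=> g k x hg xn hk; apply: (out g k) => //; left.
  - by move=> r m x hr hm xn ns dr; have [h _] := Ob r m x hr hm xn ns; apply: h.
apply: (sufficiency dT' dT (L := l) _ whirls iso _ _ ent _ _ Bb _ _ _).
- by move=> x xn h; rewrite lev //; case: h; [right|left].
- by move=> v p beta W x xn; rewrite (cong v p beta W).
- by move=> w k /pl[].
- by move=> g k x hg xn hk; apply/sub_sym/(out g k) => //; right.
- move=> m x hm hx sx ne; rewrite (sub_hgt sx); apply: Zb => //; first exact: sub_sym.
  by move=> e; apply: ne.
- move=> r m x hr hm xn ns dr; have [|_ h] := Ob r m x hr hm xn; last exact: h.
  by move=> s; apply/ns/sub_sym.
- move=> m x hm xn dx lx; rewrite maxnC; apply: Lb => //; first by move=> e; apply: dx.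
  by case: lx; [right|left].
- have [x xn [dx lx]] := wit; exists x => //.
  by split; [move=> e; apply: dx | case: lx; [right|left]].
Qed.
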